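(* For any $(p_{XY},p_{Z|XY})$, \[R_{NS}=\min_{p_{U|XYZ}} I(X,Z;U|Y),\] where the minimum is over all conditional p.m.f.'s $p_{U|XYZ}$ (with $(U,X,Y,Z)\sim p_{XY}p_{Z|XY}p_{U|XYZ}$) such that $U-X-Y$ and $Z-(U,Y)-X$ are Markov chains, and where the alphabet $\mathcal{U}$ of $U$ may be taken to satisfy $|\mathcal{U}|\le|\mathcal{X}|\cdot|\mathcal{Y}|\cdot|\mathcal{Z}|+2$.
   Context: Setup: $\mathcal{X},\mathcal{Y},\mathcal{Z}$ finite; Alice observes $X^n$, Bob observes $Y^n$, where $(X_i,Y_i)$ are i.i.d. according to $p_{XY}$; Bob wants an output distributed according to $p_{Z^n|X^nY^n}(z^n|x^n,y^n)=\prod_{i=1}^n p_{Z|XY}(z_i|x_i,y_i)$, and $p_{X^nY^nZ^n}$ denotes the resulting joint p.m.f. An $(n,2^{nR})$-code is a pair of stochastic maps $(p_{M|X^n},p_{\hat Z^n|MY^n})$ with $M\in\{1,\dots,2^{nR}\}$ (Alice sends $M$, Bob outputs $\hat Z^n$); it induces $p_{X^nY^nM\hat Z^n}=p_{X^nY^n}p_{M|X^n}p_{\hat Z^n|MY^n}$. Total variation distance: $\|p-q\|_1=\frac12\sum_u|p(u)-q(u)|$. A rate $R$ is achievable (without privacy) if there is a sequence of codes of rate $R$ such that for every $\epsilon>0$ there is a large enough $n$ with $\|p_{X^nY^n\hat Z^n}-p_{X^nY^nZ^n}\|_1\le\epsilon$. $R_{NS}$ is the infimum of achievable rates. *)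

(* Defs.v *)
From Stdlib Require Import Reals.
From mathcomp Require Import all_boot.
Set Implicit Arguments.
Unset Strict Implicit.
Unset Printing Implicit Defensive.

Local Open Scope R_scope.

Notation "\rsum_ ( i : T ) F" := (\big[Rplus/R0]_(i : T) F)
  (at level 41, F at level 41, i at level 50).
Notation "\rprod_ ( i < n ) F" := (\big[Rmult/R1]_(i < n) F)
  (at level 36, F at level 36, i at level 50).

Definition log2 (x : R) : R := ln x / ln 2.

Definition pmf (A : finType) (P : A -> R) : Prop :=
  (forall a, 0 <= P a) /\ \rsum_(a : A) P a = 1.

Definition channel (A B : finType) (W : A -> B -> R) : Prop :=
  forall a, pmf (W a).

Definition pmf2 (A B : finType) (P : A -> B -> R) : Prop :=
  (forall a b, 0 <= P a b) /\ \rsum_(a : A) \rsum_(b : B) P a b = 1.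

Definition seqn (n : nat) (A : finType) := {ffun 'I_n -> A}.

(* An (n, m)-code: stochastic encoder p_{M|X^n} and decoder p_{Zhat^n|M Y^n},
   with message set {1..m} represented as 'I_m. *)
Record code (X Y Z : finType) (n m : nat) := Code {
  enc : seqn n X -> 'I_m -> R;
  dec : 'I_m -> seqn n Y -> seqn n Z -> R }.

Definition valid_code (X Y Z : finType) (n m : nat) (c : code X Y Z n m) : Prop :=
  channel (enc c) /\ (forall w, channel (dec c w)).

Definition pXYn (X Y : finType) (pXY : X -> Y -> R) (n : nat)
  (x : seqn n X) (y : seqn n Y) : R :=
  \rprod_(i < n) pXY (x i) (y i).

Definition target (X Y Z : finType) (pXY : X -> Y -> R) (pZ : X -> Y -> Z -> R)
  (n : nat) (x : seqn n X) (y : seqn n Y) (z : seqn n Z) : R :=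
  \rprod_(i < n) (pXY (x i) (y i) * pZ (x i) (y i) (z i)).

Definition induced (X Y Z : finType) (pXY : X -> Y -> R) (n m : nat)
  (c : code X Y Z n m) (x : seqn n X) (y : seqn n Y) (z : seqn n Z) : R :=
  pXYn pXY x y * \rsum_(w : 'I_m) (enc c x w * dec c w y z).

Definition tv (X Y Z : finType) (n : nat) (P Q : seqn n X -> seqn n Y -> seqn n Z -> R) : R :=
  / 2 * \rsum_(x : seqn n X) \rsum_(y : seqn n Y) \rsum_(z : seqn n Z)
          Rabs (P x y z - Q x y z).

Definition achievable (X Y Z : finType) (pXY : X -> Y -> R) (pZ : X -> Y -> Z -> R)
  (Rate : R) : Prop :=
  exists (m : nat -> nat) (c : forall n, code X Y Z n (m n)),
    (forall n, valid_code (c n) /\ INR (m n) <= Rpower 2 (INR n * Rate)) /\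
    (forall eps, 0 < eps -> exists N : nat, forall n : nat, (N <= n)%nat ->
        tv (induced pXY (c n)) (target pXY pZ (n:=n)) <= eps).

Definition is_inf (S : R -> Prop) (r : R) : Prop :=
  (forall s, S s -> r <= s) /\ (forall b, (forall s, S s -> b <= s) -> b <= r).

Definition markov (A B C : finType) (P : A -> B -> C -> R) : Prop :=
  forall a b c,
    P a b c * (\rsum_(a' : A) \rsum_(c' : C) P a' b c')
    = (\rsum_(c' : C) P a b c') * (\rsum_(a' : A) P a' b c).

Definition cond_mi (A B C : finType) (P : A -> B -> C -> R) : R :=
  \rsum_(a : A) \rsum_(b : B) \rsum_(c : C)
    (if Rlt_dec 0 (P a b c) then
       P a b c * log2 (P a b c * (\rsum_(a' : A) \rsum_(b' : B) P a' b' c)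
                       / ((\rsum_(b' : B) P a b' c) * (\rsum_(a' : A) P a' b c)))
     else 0).

Definition jointU (X Y Z U : finType) (pXY : X -> Y -> R) (pZ : X -> Y -> Z -> R)
  (pU : X -> Y -> Z -> U -> R) (u : U) (x : X) (y : Y) (z : Z) : R :=
  pXY x y * pZ x y z * pU x y z u.

Definition markov_UXY (X Y Z U : finType) (pXY : X -> Y -> R) (pZ : X -> Y -> Z -> R)
  (pU : X -> Y -> Z -> U -> R) : Prop :=
  markov (fun (u : U) (x : X) (y : Y) => \rsum_(z : Z) jointU pXY pZ pU u x y z).

Definition markov_ZUYX (X Y Z U : finType) (pXY : X -> Y -> R) (pZ : X -> Y -> Z -> R)
  (pU : X -> Y -> Z -> U -> R) : Prop :=
  markov (fun (z : Z) (uy : (U * Y)%type) (x : X) => jointU pXY pZ pU uy.1 x uy.2 z).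

Definition I_XZ_U_given_Y (X Y Z U : finType) (pXY : X -> Y -> R)
  (pZ : X -> Y -> Z -> R) (pU : X -> Y -> Z -> U -> R) : R :=
  cond_mi (fun (xz : (X * Z)%type) (u : U) (y : Y) => jointU pXY pZ pU u xz.1 y xz.2).

Definition cond_pmf_U (X Y Z U : finType) (pU : X -> Y -> Z -> U -> R) : Prop :=
  forall x y z, pmf (pU x y z).

(* Main.v *)
(** Parametrise the auxiliary variable by two channels q(u|x) and W(z|u,y): the Markov
    conditions say exactly that the law of (X,Y,Z,U) is P(x,y) q(u|x) W(z|u,y).

    Achievability: hash every block u^n at random into a message m and an index f. If f
    ranges over fewer than exp(n H(U|X,Y,Z)) values it is almost uniform and independent of
    (X^n,Y^n,Z^n), so it can be fixed in advance; if the pairs (m,f) number more than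
    exp(n H(U|Y)), Bob recovers u^n from (m,f,y^n) and applies W. Any message rate above
    H(U|Y) - H(U|X,Y,Z) = I(X,Z;U|Y) is therefore enough.

    Converse: for a code of length n take U_i = (M, Y_j for j <> i). One application of
    Gibbs' inequality bounds the sum over i of I(X_i,Zhat_i;U_i|Y_i) - H(X_i,Y_i,Zhat_i) by
    ln m - H(X^n,Y^n,Zhat^n), and the last entropy is almost n H(X,Y,Z) because the induced
    law is close to the target; some letter i does at least as well as the average.

    The letter obtained this way simulates Z only approximately and has an unbounded
    alphabet. A conic Caratheodory argument, with linear constraints fixing the law of
    (X,Y,Z) and the value of the information, brings the alphabet down to
    |X||Y||Z| + 2 letters; a limit point in the compact space of pairs (q,W) is then exact,
    and the same limit argument shows that the minimum is attained. *)
From HB Require Import structures.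
From Stdlib Require Import ZArith Reals Lra Lia IndefiniteDescription Classical.
From mathcomp Require Import all_boot.
Require Import Defs.
Set Implicit Arguments.
Unset Strict Implicit.
Unset Printing Implicit Defensive.

Local Open Scope R_scope.

(** * Finite sums and product laws *)

(** Two obstacles shape the proof. In achievability the hash must make [f] nearly independent of
    source and output and still let Bob decode; one average over hashes bounds the sum of both
    failures, and Chebyshev's inequality already makes it of order 1/n. In the converse the source
    law is exactly i.i.d. and only Zhat^n is approximate, so every letter satisfies both Markov
    conditions exactly: U_i is independent of Y_i given X_i because the other letters are
    independent of letter i, and Zhat_i is produced from (M,Y^n), which is the same as (U_i,Y_i).
    Choosing one letter replaces the usual time-sharing variable. The price is that only the
    difference between information and entropy is controlled for that letter, and the limit argument
    has to carry this difference. Reducing the alphabet before taking the limit puts all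
    approximants into one space of fixed finite dimension. The two extra letters come from two extra
    linear constraints: the value of the information and the total weight. *)

Lemma Rplus_assocR : associative Rplus. Proof. by move=> x y z; ring. Qed.
Lemma Rmult_assocR : associative Rmult. Proof. by move=> x y z; ring. Qed.

HB.instance Definition _ :=
  Monoid.isComLaw.Build R R0 Rplus Rplus_assocR Rplus_comm Rplus_0_l.
HB.instance Definition _ :=
  Monoid.isComLaw.Build R R1 Rmult Rmult_assocR Rmult_comm Rmult_1_l.
HB.instance Definition _ := Monoid.isMulLaw.Build R R0 Rmult Rmult_0_l Rmult_0_r.
HB.instance Definition _ :=
  Monoid.isAddLaw.Build R Rmult Rplus Rmult_plus_distr_r Rmult_plus_distr_l.

Local Notation "\rsum_ ( i | P ) F" := (\big[Rplus/R0]_(i | P) F)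
  (at level 41, F at level 41, i at level 50).

Local Notation "\rsum_ ( i : T | P ) F" := (\big[Rplus/R0]_(i : T | P) F)
  (at level 41, F at level 41, i at level 50).

Section FiniteSums.
Variable T : finType.
Implicit Types (F G : T -> R) (P Q : pred T).

Lemma rsum_ge0 P F : (forall i, P i -> 0 <= F i) -> 0 <= \rsum_(i | P i) F i.
Proof. by move=> h; elim/big_ind: _ => // *; lra. Qed.

Lemma rprod_ge0 P F : (forall i, P i -> 0 <= F i) -> 0 <= \big[Rmult/R1]_(i | P i) F i.
Proof. move=> h; elim/big_ind: _ => //; [lra | exact: Rmult_le_pos]. Qed.

Lemma rprod_gt0 P F : (forall i, P i -> 0 < F i) -> 0 < \big[Rmult/R1]_(i | P i) F i.
Proof. move=> h; elim/big_ind: _ => //; [lra | exact: Rmult_lt_0_compat]. Qed.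

Lemma rsum_le P F G : (forall i, P i -> F i <= G i) ->
  \rsum_(i | P i) F i <= \rsum_(i | P i) G i.
Proof. by move=> h; elim/big_ind2: _ => // *; lra. Qed.

Lemma rsumD P F G : \rsum_(i | P i) (F i + G i) = \rsum_(i | P i) F i + \rsum_(i | P i) G i.
Proof. exact: big_split. Qed.

Lemma rsumN P F : \rsum_(i | P i) (- F i) = - \rsum_(i | P i) F i.
Proof. by elim/big_ind2: _ => // *; lra. Qed.

Lemma rsumB P F G : \rsum_(i | P i) (F i - G i) = \rsum_(i | P i) F i - \rsum_(i | P i) G i.
Proof. by rewrite /Rminus -rsumN rsumD. Qed.

Lemma rsumZl P (a : R) F : \rsum_(i | P i) (a * F i) = a * \rsum_(i | P i) F i.
Proof. by rewrite big_distrr. Qed.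

Lemma rsumZr P (a : R) F : \rsum_(i | P i) (F i * a) = (\rsum_(i | P i) F i) * a.
Proof. by rewrite big_distrl. Qed.

Lemma rsum_abs P F : Rabs (\rsum_(i | P i) F i) <= \rsum_(i | P i) Rabs (F i).
Proof.
elim/big_ind2: _ => [|x1 x2 y1 y2 h1 h2|i _]; [by rewrite Rabs_R0; lra| |lra].
by apply: Rle_trans (Rabs_triang _ _) _; lra.
Qed.

Lemma rsum_const (a : R) : \rsum_(i : T) a = INR #|T| * a.
Proof.
rewrite big_const; elim: #|T| => [|k ih]; first by rewrite /=; ring.
by rewrite iterS ih S_INR; ring.
Qed.

Lemma rsum_count P (a : R) : \rsum_(i | P i) a = INR #|P| * a.
Proof.
rewrite big_const; elim: #|P| => [|k ih]; first by rewrite /=; ring.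
by rewrite iterS ih S_INR; ring.
Qed.

Lemma rsum0 P F : (forall i, P i -> F i = 0) -> \rsum_(i | P i) F i = 0.
Proof. by move=> h; rewrite big1. Qed.

Lemma rsum_ge_term P F j : (forall i, P i -> 0 <= F i) -> P j -> F j <= \rsum_(i | P i) F i.
Proof.
move=> h pj; rewrite (bigD1 j) //=.
suff: 0 <= \rsum_(i | P i && (i != j)) F i by lra.
by apply: rsum_ge0 => i /andP[pi _]; apply: h.
Qed.

Lemma rsum_eq0 P F : (forall i, P i -> 0 <= F i) -> \rsum_(i | P i) F i = 0 ->
  forall i, P i -> F i = 0.
Proof.
move=> h h0 i pi; have := rsum_ge_term h pi; have := h i pi; lra.
Qed.

Lemma rsum_delta (j : T) F : \rsum_(i : T) (if i == j then F i else 0) = F j.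
Proof. by rewrite -big_mkcond /= big_pred1_eq. Qed.

Lemma rsum_if P F : \rsum_(i : T) (if P i then F i else 0) = \rsum_(i | P i) F i.
Proof. by rewrite -big_mkcond. Qed.

Lemma rsum_subpred P Q F : (forall i, 0 <= F i) -> (forall i, P i -> Q i) ->
  \rsum_(i | P i) F i <= \rsum_(i | Q i) F i.
Proof.
move=> h pq; rewrite -(rsum_if P) -(rsum_if Q); apply: rsum_le => i _.
by case: ifP => [/pq -> | _]; [lra | case: ifP => // _; lra].
Qed.

End FiniteSums.

Lemma rsum_pair (A B : finType) (F : A * B -> R) :
  \rsum_(p : A * B) F p = \rsum_(a : A) \rsum_(b : B) F (a, b).
Proof. by rewrite pair_bigA; apply: eq_bigr => -[]. Qed.

Lemma rsum_fiber (A B : finType) (f : A -> B) (F : A -> R) :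
  \rsum_(b : B) \rsum_(a | f a == b) F a = \rsum_(a : A) F a.
Proof.
rewrite [RHS](partition_big f xpredT) //=.
Qed.

Lemma rsum_reindex (A B : finType) (f : A -> B) (g : B -> A) (F : B -> R) :
  cancel f g -> cancel g f -> \rsum_(b : B) F b = \rsum_(a : A) F (f a).
Proof. by move=> fg gf; rewrite (reindex f) //; exists g => ? _. Qed.

(** The probabilistic method, applied to the random hash, to the index [f], and to the choice of a
    letter in the converse. *)
Lemma pmf_exists_le (T : finType) (p F : T -> R) (B : R) :
  pmf p -> \rsum_(i : T) (p i * F i) <= B -> exists i, F i <= B.
Proof.
move=> [p0 p1] h; apply: NNPP => nex.
have hF i : B < F i by apply: Rnot_le_lt => hi; apply: nex; exists i.
have h1 i : 0 <= p i * (F i - B) by apply: Rmult_le_pos => //; have := hF i; lra.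
have e : \rsum_(i : T) (p i * (F i - B)) = \rsum_(i : T) (p i * F i) - B.
  rewrite -[in RHS](Rmult_1_l B) -p1 -rsumZr -rsumB; apply: eq_bigr => i _; ring.
have s0 : \rsum_(i : T) (p i * (F i - B)) = 0.
  by have := @rsum_ge0 _ xpredT _ (fun i _ => h1 i); rewrite e; lra.
have z i : p i = 0.
  have := rsum_eq0 (fun i _ => h1 i) s0 (isT : xpredT i).
  by case/Rmult_integral => //; have := hF i; lra.
by move: p1; rewrite rsum0 //; lra.
Qed.

Lemma pmf_inhab (T : finType) (p : T -> R) : pmf p -> T.
Proof.
case: (pickP (@predT T)) => [x _ _ //|h [_ p1]].
by exfalso; move: p1; rewrite big_pred0 //; lra.
Qed.

Lemma pmf2_inhab (A B : finType) (P : A -> B -> R) : pmf2 P -> inhabited A.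
Proof.
move=> hP; case: (pickP (@predT A)) => [x _|h]; first by constructor.
by have := proj2 hP; rewrite big_pred0 //; lra.
Qed.

(** * Moments of product laws *)

Section ProductLaw.
Variables (I A : finType).

Definition prodlaw (p : A -> R) (f : {ffun I -> A}) : R := \big[Rmult/R1]_(i : I) p (f i).

Lemma rsum_ffun_prod (g : I -> A -> R) :
  \rsum_(f : {ffun I -> A}) \big[Rmult/R1]_(i : I) g i (f i)
  = \big[Rmult/R1]_(i : I) \rsum_(a : A) g i a.
Proof. by rewrite bigA_distr_bigA. Qed.

Variable p : A -> R.
Hypothesis hp : pmf p.

Lemma prodlaw_ge0 f : 0 <= prodlaw p f.
Proof. by apply: rprod_ge0 => i _; case: hp. Qed.

Lemma prodlaw_pmf : pmf (prodlaw p).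
Proof.
split; first exact: prodlaw_ge0.
rewrite /prodlaw (rsum_ffun_prod (fun _ => p)) big1 // => i _; by case: hp.
Qed.

(** Coordinate [i0] absorbs the factor [phi], so the integrand is again a product and the sum
    factors over coordinates. *)
Lemma prodlaw_expect (i0 : I) (phi : A -> R) :
  \rsum_(f : {ffun I -> A}) (prodlaw p f * phi (f i0)) = \rsum_(a : A) (p a * phi a).
Proof.
pose g i a := p a * (if i == i0 then phi a else 1).
transitivity (\rsum_(f : {ffun I -> A}) \big[Rmult/R1]_(i : I) g i (f i)).
  apply: eq_bigr => f _; rewrite /prodlaw /g big_split /=; congr (_ * _).
  by rewrite -big_mkcond /= big_pred1_eq.
rewrite rsum_ffun_prod (bigD1 i0) //= [X in _ * X]big1 ?Rmult_1_r => [|i /negbTE ne].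
  by apply: eq_bigr => a _; rewrite /g eqxx.
by transitivity (\rsum_(a : A) p a); last (by case: hp); apply: eq_bigr => a _; rewrite /g ne Rmult_1_r.
Qed.

Lemma prodlaw_expect2 (i0 i1 : I) (phi psi : A -> R) : i0 != i1 ->
  \rsum_(f : {ffun I -> A}) (prodlaw p f * (phi (f i0) * psi (f i1)))
  = (\rsum_(a : A) (p a * phi a)) * (\rsum_(a : A) (p a * psi a)).
Proof.
move=> ne01.
pose g i a := p a * ((if i == i0 then phi a else 1) * (if i == i1 then psi a else 1)).
transitivity (\rsum_(f : {ffun I -> A}) \big[Rmult/R1]_(i : I) g i (f i)).
  apply: eq_bigr => f _; rewrite /prodlaw /g !big_split /=; congr (_ * (_ * _)).
    by rewrite -big_mkcond /= big_pred1_eq.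
  by rewrite -big_mkcond /= big_pred1_eq.
rewrite rsum_ffun_prod (bigD1 i0) //= (bigD1 i1) /=; last by rewrite eq_sym.
rewrite [X in _ * (_ * X)]big1 ?Rmult_1_r => [|i /andP[/negbTE n0 /negbTE n1]].
  congr (_ * _); apply: eq_bigr => a _; rewrite /g ?eqxx ?(negbTE ne01) /=.
    by rewrite Rmult_1_r.
  by rewrite eq_sym (negbTE ne01) Rmult_1_l.
by transitivity (\rsum_(a : A) p a); last (by case: hp); apply: eq_bigr => a _; rewrite /g n0 n1 !Rmult_1_r.
Qed.

(** Off-diagonal terms factor by independence and vanish by centring. The summand may vary with the
    coordinate: for hashing, the coordinates are the points of [U], each carrying its own weight. *)
Lemma prodlaw_var (phi : I -> A -> R) : (forall i, \rsum_(a : A) (p a * phi i a) = 0) ->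
  \rsum_(f : {ffun I -> A}) (prodlaw p f * (\rsum_(i : I) phi i (f i)) ^ 2)
  = \rsum_(i : I) \rsum_(a : A) (p a * phi i a ^ 2).
Proof.
move=> phi0.
transitivity (\rsum_(i : I) \rsum_(j : I) \rsum_(f : {ffun I -> A})
    (prodlaw p f * (phi i (f i) * phi j (f j)))).
  rewrite [RHS](eq_bigr (fun i => \rsum_(f : {ffun I -> A}) \rsum_(j : I)
    (prodlaw p f * (phi i (f i) * phi j (f j))))); last first.
    by move=> i _; rewrite exchange_big.
  rewrite exchange_big /=; apply: eq_bigr => f _.
  rewrite /= Rmult_1_r -rsumZr -rsumZl; apply: eq_bigr => i _.
  by rewrite -!rsumZl.
apply: eq_bigr => i _.
rewrite (bigD1 i) //= [X in _ + X]big1 => [|j ne]; last first.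
  by rewrite prodlaw_expect2 1?eq_sym // phi0 Rmult_0_l.
rewrite Rplus_0_r -(prodlaw_expect i); apply: eq_bigr => f _ /=; ring.
Qed.

End ProductLaw.

Section WeakLaw.
Variables (A : finType) (p : A -> R) (g : A -> R) (n : nat) (d : R).
Hypotheses (hp : pmf p) (hn : (0 < n)%N) (hd : 0 < d).
Let mu := \rsum_(a : A) (p a * g a).
Let V := \rsum_(a : A) (p a * (g a - mu) ^ 2).

(* The bad event is only required to force a deviation on the support of the law. *)
Lemma weak_law (bad : pred {ffun 'I_n -> A}) :
  (forall f, bad f -> 0 < prodlaw p f ->
     INR n * d <= Rabs (\rsum_(i : 'I_n) g (f i) - INR n * mu)) ->
  \rsum_(f | bad f) prodlaw p f <= V / d ^ 2 / INR n.
Proof.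
move=> hbad; have n0 : 0 < INR n by apply: lt_0_INR; apply/ltP.
have c0 : \rsum_(a : A) (p a * (g a - mu)) = 0.
  rewrite (eq_bigr (fun a => p a * g a - p a * mu)); last by move=> *; ring.
  by rewrite rsumB rsumZr; case: hp => _ ->; rewrite -/mu; ring.
have var := prodlaw_var hp (fun _ : 'I_n => c0); rewrite -/V rsum_const card_ord in var.
have nd : 0 < (INR n * d) ^ 2 by apply: pow_lt; apply: Rmult_lt_0_compat.
suff h : ((INR n * d) ^ 2 * (\rsum_(f | bad f) prodlaw p f) <= INR n * V)%R.
  apply: (Rmult_le_reg_l ((INR n * d) ^ 2)) => //.
  apply: Rle_trans h _; apply: Req_le; field; lra.
rewrite -var -rsumZl -(rsum_if bad); apply: rsum_le => f _.
have p0 := prodlaw_ge0 hp f.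
case: ifP => [bf|_]; last by apply: Rmult_le_pos => //; apply: pow2_ge_0.
case: p0 => [p0|<-]; last by lra.
rewrite Rmult_comm; apply: Rmult_le_compat_l; first lra.
have -> : \rsum_(i : 'I_n) (g (f i) - mu) = \rsum_(i : 'I_n) g (f i) - INR n * mu.
  by rewrite rsumB rsum_const card_ord.
rewrite -(pow2_abs (_ - _)); apply: pow_incr; split; last exact: hbad.
by apply: Rmult_le_pos; lra.
Qed.

End WeakLaw.

(** * One-shot simulation by random binning *)

Definition joint (X Y Z U : finType) (P : X -> Y -> R) (q : X -> U -> R)
  (W : U -> Y -> Z -> R) (x : X) (y : Y) (z : Z) (u : U) : R :=
  P x y * q x u * W u y z.

Definition jointXYZ (X Y Z U : finType) (P : X -> Y -> R) (q : X -> U -> R)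
  (W : U -> Y -> Z -> R) (x : X) (y : Y) (z : Z) : R :=
  \rsum_(u : U) joint P q W x y z u.

Section Hashing.
Variables (U V : finType).
Hypothesis hV : (0 < #|V|)%N.

Definition hashlaw : {ffun U -> V} -> R := prodlaw (fun _ => / INR #|V|).

Lemma INR_card_gt0 : 0 < INR #|V|. Proof. by apply: lt_0_INR; apply/ltP. Qed.

Lemma unif_pmf : pmf (fun _ : V => / INR #|V|).
Proof.
have h := INR_card_gt0; split=> [_|]; first by apply/Rlt_le/Rinv_0_lt_compat.
rewrite rsum_const; field; lra.
Qed.

Lemma hashlaw_pmf : pmf hashlaw. Proof. exact: prodlaw_pmf unif_pmf. Qed.

Lemma hash_collision (u u' : U) : u != u' ->
  \rsum_(b : {ffun U -> V}) (hashlaw b * (if b u == b u' then 1 else 0)) = / INR #|V|.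
Proof.
move=> ne; have h := INR_card_gt0.
transitivity (\rsum_(v : V) \rsum_(b : {ffun U -> V}) (hashlaw b *
   ((if b u == v then 1 else 0) * (if b u' == v then 1 else 0)))).
  rewrite exchange_big /=; apply: eq_bigr => b _; rewrite rsumZl; congr (_ * _).
  rewrite (bigD1 (b u')) //= eqxx Rmult_1_r big1 ?Rplus_0_r // => v ne'.
  by rewrite [b u' == v]eq_sym (negbTE ne') Rmult_0_r.
have d v : \rsum_(a : V) (/ INR #|V| * (if a == v then 1 else 0)) = / INR #|V|.
  by rewrite rsumZl (rsum_delta v (fun=> 1)) Rmult_1_r.
rewrite (eq_bigr (fun _ => / INR #|V| * / INR #|V|)) => [|v _]; last first.
  by rewrite (prodlaw_expect2 unif_pmf (fun a => if a == v then 1 else 0)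
    (fun a => if a == v then 1 else 0) ne) d.
rewrite rsum_const; field; lra.
Qed.

End Hashing.

(** A linear substitute for Jensen's inequality: if the mean of [D ^ 2] is at most [c ^ 2],
    averaging this bound shows that the mean of [Rabs D] is at most [c]. *)
Lemma abs_le_sqr (c D : R) : 0 < c -> Rabs D <= D ^ 2 / (2 * c) + c / 2.
Proof.
move=> c0; rewrite -pow2_abs; set a := Rabs D.
apply: (Rmult_le_reg_l (2 * c)); first lra.
have -> : 2 * c * (a ^ 2 / (2 * c) + c / 2) = a ^ 2 + c ^ 2 by field; lra.
have := pow2_ge_0 (a - c); nra.
Qed.

(** * Random bins: uniformity and collisions *)

Section Binning.
Variables (U : finType) (M L : nat).
Hypotheses (hM : (0 < M)%N) (hL : (0 < L)%N).
Let V : finType := ('I_M * 'I_L)%type.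

Let hV : (0 < #|V|)%N. Proof. by rewrite card_prod !card_ord muln_gt0 hM. Qed.
Let cV : INR #|V| = INR M * INR L. Proof. by rewrite card_prod !card_ord mult_INR. Qed.
Let M0 : 0 < INR M. Proof. by apply: lt_0_INR; apply/ltP. Qed.
Let L0 : 0 < INR L. Proof. by apply: lt_0_INR; apply/ltP. Qed.

(** Leftover hashing for one index [f]. The deviation of its bin mass from the mean is a sum of
    independent centred terms, one for each [u]; its variance is (L-1)/L^2 times the sum of
    [j u ^ 2], which is at most [s * t ^ 2]. The bound [t] is kept apart from the total of [j]
    because the lemma is applied to a truncated weight with the total of the untruncated one. *)
Lemma bin_uniform_step (f : 'I_L) (j : U -> R) (s t k : R) :
  (forall u, 0 <= j u) -> (forall u, j u <= s * t) -> \rsum_(u : U) j u <= t ->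
  0 <= s -> 0 < k -> (INR L - 1) * s <= k ^ 2 ->
  \rsum_(b : {ffun U -> V}) (hashlaw b *
     Rabs (\rsum_(u | (b u).2 == f) j u - (\rsum_(u : U) j u) / INR L))
  <= k * t / INR L.
Proof.
move=> j0 js jt hs k0 hk.
have hl := hashlaw_pmf U hV.
have s0 := @rsum_ge0 _ xpredT _ (fun u _ => j0 u).
pose psi (u : U) (v : V) := j u * ((if v.2 == f then 1 else 0) - / INR L).
have eD (b : {ffun U -> V}) :
    \rsum_(u | (b u).2 == f) j u - (\rsum_(u : U) j u) / INR L
    = \rsum_(u : U) psi u (b u).
  rewrite -(rsum_if (fun u => (b u).2 == f)) /Rdiv -rsumZr -rsumB.
  by apply: eq_bigr => u _; rewrite /psi; case: ifP => _; ring.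
have [t0|t0] : 0 < t \/ t = 0 by lra.
  2: {
  rewrite t0 [X in X <= _]rsum0 => [|b _]; first lra.
  rewrite eD rsum0 ?Rabs_R0 ?Rmult_0_r // => u _.
  have -> : psi u (b u) = 0; last by [].
  rewrite /psi; have -> : j u = 0; last by rewrite Rmult_0_l.
  by have := js u; have := j0 u; rewrite t0; lra. }
have sV (F : V -> R) : \rsum_(v : V) (/ INR #|V| * F v)
    = / (INR M * INR L) * \rsum_(v : V) F v by rewrite rsumZl cV.
have sf (a b : R) : \rsum_(v : V) (if v.2 == f then a else b)
    = INR M * (a + (INR L - 1) * b).
  rewrite rsum_pair /= (eq_bigr (fun _ => a + (INR L - 1) * b)); last first.
    move=> i _; rewrite (eq_bigr (fun l => b + (if l == f then a - b else 0))).
      by rewrite rsumD rsum_const card_ord (rsum_delta f (fun=> a - b)); ring.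
    by move=> l _; case: ifP => _; ring.
  by rewrite rsum_const card_ord.
have c0 u : \rsum_(v : V) (/ INR #|V| * psi u v) = 0.
  rewrite sV /psi rsumZl (eq_bigr (fun v : V => if v.2 == f then 1 - / INR L else - / INR L)).
    by rewrite sf; field; lra.
  by move=> v _; case: ifP => _; ring.
have var := prodlaw_var (unif_pmf hV) c0.
have e2 u : \rsum_(v : V) (/ INR #|V| * psi u v ^ 2) = j u ^ 2 * ((INR L - 1) / INR L ^ 2).
  rewrite sV /psi (eq_bigr (fun v : V => j u ^ 2 *
     (if v.2 == f then (1 - / INR L) ^ 2 else / INR L ^ 2))).
    by rewrite rsumZl sf; field; lra.
  by move=> v _; case: ifP => _; field; lra.
rewrite (eq_bigr _ (fun u _ => e2 u)) rsumZr in var.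
(* The target bound itself is the scale in [abs_le_sqr]; both of its terms then average to at most
   [c / 2]. *)
set c := k * t / INR L.
have hc : 0 < c by apply: Rdiv_lt_0_compat => //; apply: Rmult_lt_0_compat.
have L1 : 1 <= INR L by apply: (le_INR 1); apply/leP.
have hD : \rsum_(b : {ffun U -> V}) (hashlaw b * (\rsum_(u : U) psi u (b u)) ^ 2) <= c ^ 2.
  rewrite [X in X <= _]var.
  have j2 : \rsum_(u : U) j u ^ 2 <= s * t ^ 2.
    apply: (Rle_trans _ (\rsum_(u : U) (s * t * j u))).
      by apply: rsum_le => u _; have := js u; have := j0 u; nra.
    by rewrite rsumZl; have := Rmult_le_pos _ _ hs (Rlt_le _ _ t0); nra.
  have -> : c ^ 2 = (k ^ 2 * t ^ 2) * / INR L ^ 2 by rewrite /c; field; lra.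
  rewrite /Rdiv -Rmult_assoc; apply: Rmult_le_compat_r.
    by apply/Rlt_le/Rinv_0_lt_compat; apply: pow_lt.
  have t2 := pow2_ge_0 t.
  by nra.
apply: (Rle_trans _ (\rsum_(b : {ffun U -> V})
    (hashlaw b * (\rsum_(u : U) psi u (b u)) ^ 2 * / (2 * c) + hashlaw b * (c / 2)))).
  apply: rsum_le => b _; rewrite eD.
  have := abs_le_sqr (\rsum_(u : U) psi u (b u)) hc.
  move=> /(Rmult_le_compat_l _ _ _ (proj1 hl b)); rewrite /Rdiv.
  by set x := (\rsum_(u : U) _) ^ 2; nra.
rewrite rsumD !rsumZr (proj2 hl) Rmult_1_l.
have : c ^ 2 * / (2 * c) = c / 2 by field; lra.
have i0 : 0 < / (2 * c) by apply: Rinv_0_lt_compat; lra.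
by move: hD i0; set x := \rsum_(b : _) _; nra.
Qed.

(** Atoms outside [ok] may be too heavy for the variance bound and are cut off. Each is charged
    twice: in the bin that receives it, and in the uniform share of the total. *)
Lemma bin_uniform (j : U -> R) (ok : pred U) (s k : R) :
  (forall u, 0 <= j u) -> (forall u, ok u -> j u <= s * \rsum_(u' : U) j u') ->
  0 <= s -> 0 < k -> (INR L - 1) * s <= k ^ 2 ->
  \rsum_(b : {ffun U -> V}) (hashlaw b * \rsum_(f : 'I_L)
     Rabs (\rsum_(u | (b u).2 == f) j u - (\rsum_(u : U) j u) / INR L))
  <= k * (\rsum_(u : U) j u) + 2 * \rsum_(u | ~~ ok u) j u.
Proof.
move=> j0 js hs k0 hk.
have hl := hashlaw_pmf U hV.
set t := \rsum_(u : U) j u in js *.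
have t0 : 0 <= t by apply: rsum_ge0.
pose j1 u := if ok u then j u else 0.
pose j2 u := if ok u then 0 else j u.
have jE u : j u = j1 u + j2 u by rewrite /j1 /j2; case: ifP => _; ring.
have j1p u : 0 <= j1 u by rewrite /j1; case: ifP => // _; lra.
have j2p u : 0 <= j2 u by rewrite /j2; case: ifP => // _; lra.
have -> : \rsum_(u | ~~ ok u) j u = \rsum_(u : U) j2 u.
  by rewrite -(rsum_if (fun u => ~~ ok u)); apply: eq_bigr => u _; rewrite /j2; case: (ok u).
apply: (Rle_trans _ (\rsum_(b : {ffun U -> V}) (hashlaw b * (\rsum_(f : 'I_L)
     Rabs (\rsum_(u | (b u).2 == f) j1 u - (\rsum_(u : U) j1 u) / INR L)) +
   hashlaw b * (2 * \rsum_(u : U) j2 u)))).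
  apply: rsum_le => b _; rewrite -Rmult_plus_distr_l.
  apply: Rmult_le_compat_l; first exact: (proj1 hl).
  have -> : 2 * (\rsum_(u : U) j2 u) =
     \rsum_(f : 'I_L) (\rsum_(u | (b u).2 == f) j2 u + (\rsum_(u : U) j2 u) / INR L).
    rewrite rsumD rsum_const card_ord (rsum_fiber (fun u => (b u).2)); field; lra.
  rewrite -rsumD; apply: rsum_le => f _.
  rewrite /t (eq_bigr _ (fun u _ => jE u)) [X in _ - X / _](eq_bigr _ (fun u _ => jE u)) !rsumD.
  have p1 : 0 <= \rsum_(u | (b u).2 == f) j2 u by apply: rsum_ge0.
  have p2 : 0 <= (\rsum_(u : U) j2 u) / INR L.
    by apply: Rmult_le_pos; [apply: rsum_ge0 | apply/Rlt_le/Rinv_0_lt_compat].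
  set A := \rsum_(u | _) j1 u; set B := \rsum_(u | _) j2 u in p1 *.
  set A' := \rsum_(u : U) j1 u; set B' := (\rsum_(u : U) j2 u) in p2 *.
  have -> : A + B - (A' + B') / INR L = (A - A' / INR L) + (B - B' / INR L) by field; lra.
  apply: Rle_trans (Rabs_triang _ _) _; apply: Rplus_le_compat_l.
  by apply: Rabs_le; lra.
rewrite rsumD rsumZr (proj2 hl) Rmult_1_l; apply: Rplus_le_compat_r.
rewrite (eq_bigr (fun b => \rsum_(f : 'I_L) (hashlaw b *
     Rabs (\rsum_(u | (b u).2 == f) j1 u - (\rsum_(u : U) j1 u) / INR L)))) => [|b _]; last first.
  by rewrite rsumZl.
rewrite exchange_big /=.
apply: (Rle_trans _ (\rsum_(f : 'I_L) (k * t / INR L))).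
  apply: rsum_le => f _; apply: (@bin_uniform_step f j1 s t k) => //.
    move=> u; rewrite /j1; case: ifP => [/js //|_]; exact: Rmult_le_pos.
  by apply: rsum_le => u _; rewrite (jE u); have := j2p u; lra.
by rewrite rsum_const card_ord; apply: Req_le; field; lra.
Qed.

Lemma bin_collision (good : pred U) (u : U) :
  \rsum_(b : {ffun U -> V}) (hashlaw b *
     \rsum_(u' | good u' && (u' != u)) (if b u' == b u then 1 else 0))
  <= INR #|good| / (INR M * INR L).
Proof.
rewrite (eq_bigr (fun b => \rsum_(u' | good u' && (u' != u))
   (hashlaw b * (if b u' == b u then 1 else 0)))) => [|b _]; last by rewrite rsumZl.
rewrite exchange_big /= (eq_bigr (fun _ => / (INR M * INR L))) => [|u' /andP[_ ne]]; last first.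
  by rewrite (hash_collision hV ne) cV.
rewrite /Rdiv -rsum_count; apply: rsum_subpred => [_|u' /andP[] //].
by apply/Rlt_le/Rinv_0_lt_compat/Rmult_lt_0_compat.
Qed.

End Binning.

(** * Encoder, decoder and error of the binning scheme *)

Section OneShot.
Variables (X Y Z U : finType) (P : X -> Y -> R) (q : X -> U -> R) (W : U -> Y -> Z -> R).
Hypotheses (hP : pmf2 P) (hq : channel q) (hW : forall u, channel (W u)).
Variables (M L : nat).
Hypotheses (hM : (0 < M)%N) (hL : (0 < L)%N).
Variables (good : Y -> pred U) (u0 : U).
Let V : finType := ('I_M * 'I_L)%type.
Let J := joint P q W.
Let T := jointXYZ P q W.
Implicit Types (b : {ffun U -> V}) (f : 'I_L) (m : 'I_M).

Lemma joint_ge0 x y z u : 0 <= joint P q W x y z u.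
Proof.
rewrite /joint; apply: Rmult_le_pos; last by case: (hW u y).
by apply: Rmult_le_pos; [case: hP | case: (hq x)].
Qed.

Lemma jointXYZ_ge0 x y z : 0 <= jointXYZ P q W x y z.
Proof. by apply: rsum_ge0 => u _; apply: joint_ge0. Qed.

Lemma joint_sumZ x y u : \rsum_(z : Z) joint P q W x y z u = P x y * q x u.
Proof. by rewrite /joint rsumZl; case: (hW u y) => _ ->; rewrite Rmult_1_r. Qed.

Lemma jointXYZ_sumZ x y : \rsum_(z : Z) jointXYZ P q W x y z = P x y.
Proof.
rewrite /jointXYZ exchange_big /= (eq_bigr _ (fun u _ => joint_sumZ x y u)) rsumZl.
by case: (hq x) => _ ->; rewrite Rmult_1_r.
Qed.

Definition binmass b x f : R := \rsum_(u | (b u).2 == f) q x u.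

(** The posterior law of the message given [x] and the index [f], when [u] is drawn from [q x] and
    hashed. On a bin of zero mass the uniform law keeps it a channel. *)
Definition bin_enc b f x m : R :=
  if Rlt_dec 0 (binmass b x f) then (\rsum_(u | b u == (m, f)) q x u) / binmass b x f
  else / INR M.

Definition bin_guess b f m y : option U := [pick u | (b u == (m, f)) && good y u].

Definition bin_dec b f m y z : R := W (odflt u0 (bin_guess b f m y)) y z.

Lemma bin_dec_channel b f m : channel (bin_dec b f m).
Proof. by move=> y; apply: hW. Qed.

Lemma sum_bins b f (F : U -> R) :
  \rsum_(m : 'I_M) \rsum_(u | b u == (m, f)) F u = \rsum_(u | (b u).2 == f) F u.
Proof.
rewrite [RHS](partition_big (fun u => (b u).1) xpredT) //=.
apply: eq_bigr => m _; apply: eq_bigl => u.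
by case: (b u) => m' f'; rewrite xpair_eqE andbC.
Qed.

Lemma bin_enc_channel b f : channel (bin_enc b f).
Proof.
move=> x; rewrite /bin_enc; case: Rlt_dec => h /=; last first.
  have := @unif_pmf 'I_M; rewrite card_ord; exact.
split=> [m|]; last by rewrite rsumZr sum_bins -/(binmass b x f); field; lra.
apply: Rmult_le_pos; last by apply/Rlt_le/Rinv_0_lt_compat.
by apply: rsum_ge0 => u _; case: (hq x).
Qed.

Lemma binmass_enc b f x m :
  binmass b x f * bin_enc b f x m = \rsum_(u | b u == (m, f)) q x u.
Proof.
have q0 u : 0 <= q x u by case: (hq x).
rewrite /bin_enc; case: Rlt_dec => h /=; first by field; lra.
have h0 : binmass b x f = 0.
  by have := @rsum_ge0 _ (fun u => (b u).2 == f) (q x) (fun u _ => q0 u); rewrite -/(binmass b x f); lra.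
rewrite h0 Rmult_0_l rsum0 // => u /eqP bu.
by apply: (rsum_eq0 (fun u _ => q0 u) h0); rewrite bu.
Qed.

Lemma binmass_dec b f x y z :
  binmass b x f * (\rsum_(m : 'I_M) (bin_enc b f x m * bin_dec b f m y z))
  = \rsum_(u | (b u).2 == f) (q x u * bin_dec b f (b u).1 y z).
Proof.
rewrite -rsumZl -sum_bins; apply: eq_bigr => m _.
rewrite -Rmult_assoc binmass_enc -rsumZr; apply: eq_bigr => u /eqP -> //.
Qed.

Definition bin_err b y u := bin_guess b (b u).2 (b u).1 y != Some u.

(** The joint weight of [(x, y, z)] with the hashed index [f], minus the weight that a uniform index
    independent of [(x, y, z)] would have. *)
Definition bias b x y z f : R :=
  \rsum_(u | (b u).2 == f) J x y z u - T x y z / INR L.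

(** The error has three sources: Alice normalises by the actual mass of bin [f] instead of 1/L, Bob
    may apply [W] to a wrong letter, and the index is biased. The first reduces to the third, since
    summing [bias] over [z] gives the deviation of the bin mass; hence the factor 2 on the bias. The
    other 2 bounds the L1 distance of two laws on [Z]. *)
Lemma binning_pointwise b x y :
  \rsum_(z : Z) \rsum_(f : 'I_L) Rabs
      (P x y * (\rsum_(m : 'I_M) (bin_enc b f x m * bin_dec b f m y z)) / INR L - T x y z / INR L)
  <= 2 * (\rsum_(z : Z) \rsum_(f : 'I_L) Rabs (bias b x y z f))
     + 2 * (\rsum_(u | bin_err b y u) (P x y * q x u)).
Proof.
have p0 : 0 <= P x y by case: hP.
have L0 : 0 < INR L by apply: lt_0_INR; apply/ltP.
pose D f z := \rsum_(m : 'I_M) (bin_enc b f x m * bin_dec b f m y z).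
have D0 f z : 0 <= D f z.
  apply: rsum_ge0 => m _; apply: Rmult_le_pos; first by case: (bin_enc_channel b f x).
  by case: (bin_dec_channel b f m y).
have D1 f : \rsum_(z : Z) D f z = 1.
  rewrite /D exchange_big /=.
  transitivity (\rsum_(m : 'I_M) bin_enc b f x m); last by case: (bin_enc_channel b f x).
  by apply: eq_bigr => m _; rewrite rsumZl; case: (bin_dec_channel b f m y) => _ ->; ring.
pose E f z := P x y * \rsum_(u | (b u).2 == f)
   (q x u * Rabs (bin_dec b f (b u).1 y z - W u y z)).
apply: (Rle_trans _ (\rsum_(z : Z) \rsum_(f : 'I_L)
   (P x y * Rabs (/ INR L - binmass b x f) * D f z + E f z + Rabs (bias b x y z f)))).
  apply: rsum_le => z _; apply: rsum_le => f _; rewrite -/(D f z).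
  have -> : P x y * D f z / INR L - T x y z / INR L
     = P x y * (/ INR L - binmass b x f) * D f z
       + P x y * (\rsum_(u | (b u).2 == f) (q x u * (bin_dec b f (b u).1 y z - W u y z)))
       + bias b x y z f.
    have -> : \rsum_(u | (b u).2 == f) (q x u * (bin_dec b f (b u).1 y z - W u y z))
       = binmass b x f * D f z - \rsum_(u | (b u).2 == f) (q x u * W u y z).
      rewrite binmass_dec -rsumB; apply: eq_bigr => u _; ring.
    have e : \rsum_(u | (b u).2 == f) J x y z u
       = P x y * \rsum_(u | (b u).2 == f) (q x u * W u y z).
      by rewrite -rsumZl; apply: eq_bigr => u _; rewrite /J /joint; ring.
    by rewrite /bias e /Rdiv; ring.
  apply: Rle_trans (Rabs_triang _ _) _; apply: Rplus_le_compat_r.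
  apply: Rle_trans (Rabs_triang _ _) _; apply: Rplus_le_compat.
    by rewrite !Rabs_mult (Rabs_pos_eq (P x y)) // (Rabs_pos_eq (D f z)) //; lra.
  rewrite Rabs_mult (Rabs_pos_eq (P x y)) //; apply: Rmult_le_compat_l => //.
  apply: Rle_trans (rsum_abs _ _) _; apply: rsum_le => u _.
  by rewrite Rabs_mult (Rabs_pos_eq (q x u)); [lra | case: (hq x)].
rewrite (eq_bigr _ (fun z _ => rsumD _ _ _)) rsumD (eq_bigr _ (fun z _ => rsumD _ _ _)) rsumD.
set A := \rsum_(z : Z) _; set B := \rsum_(z : Z) _; set C := \rsum_(z : Z) _.
have hA : A <= C.
  rewrite /A /C exchange_big [X in _ <= X]exchange_big /=; apply: rsum_le => f _.
  rewrite rsumZl D1 Rmult_1_r; apply: Rle_trans (rsum_abs _ _).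
  rewrite /bias rsumB rsumZr jointXYZ_sumZ exchange_big /=.
  rewrite (eq_bigr _ (fun u _ => joint_sumZ x y u)) rsumZl -/(binmass b x f).
  have -> : P x y * binmass b x f - P x y * / INR L = - (P x y * (/ INR L - binmass b x f)) by ring.
  by rewrite Rabs_Ropp Rabs_mult (Rabs_pos_eq (P x y)) //; lra.
suff hB : B <= 2 * (\rsum_(u | bin_err b y u) (P x y * q x u)) by lra.
rewrite /B exchange_big /=.
rewrite (eq_bigr (fun f => \rsum_(u | (b u).2 == f) (P x y * q x u *
   \rsum_(z : Z) Rabs (bin_dec b (b u).2 (b u).1 y z - W u y z)))) => [|f _]; last first.
  rewrite /E rsumZl exchange_big /= -rsumZl; apply: eq_bigr => u /eqP ->.
  by rewrite rsumZl; ring.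
rewrite (rsum_fiber (fun u => (b u).2)) -rsumZl -[X in _ <= X](rsum_if (bin_err b y)).
apply: rsum_le => u _; have pq : 0 <= P x y * q x u by apply: Rmult_le_pos => //; case: (hq x).
case: ifP => [_|/negbT]; last first.
  rewrite negbK => /eqP g; rewrite rsum0 ?Rmult_0_r; first lra.
  by move=> z _; rewrite /bin_dec g /= Rminus_diag_eq // Rabs_R0.
rewrite [X in _ <= X]Rmult_comm; apply: Rmult_le_compat_l => //.
apply: (Rle_trans _ (\rsum_(z : Z) (bin_dec b (b u).2 (b u).1 y z + W u y z))).
  apply: rsum_le => z _; apply: Rabs_le.
  have := proj1 (hW u y) z; have := proj1 (bin_dec_channel b (b u).2 (b u).1 y) z; lra.
by rewrite rsumD (proj2 (hW u y)) (proj2 (bin_dec_channel b _ _ y)); lra.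
Qed.

Lemma Rabs_scale (a : R) (c : R) : 0 < c -> Rabs a * / c = Rabs (a / c).
Proof.
by move=> c0; rewrite /Rdiv Rabs_mult (Rabs_pos_eq (/ c)) //; apply/Rlt_le/Rinv_0_lt_compat.
Qed.

(** [L] must be small against [k ^ 2 / s] for [f] to look independent, while [INR M * INR L] must be
    large against [/ tau] for decoding. Both errors are averaged over the same hash, so a single [b]
    serves for both; a second averaging fixes [f]. *)
Lemma one_shot_simulation (ok : X -> Y -> Z -> pred U) (s k tau : R) :
  (forall x y z u, ok x y z u -> joint P q W x y z u <= s * jointXYZ P q W x y z) ->
  0 <= s -> 0 < k -> (INR L - 1) * s <= k ^ 2 -> 0 < tau ->
  (forall y u, good y u -> tau * (\rsum_(x : X) P x y) <= \rsum_(x : X) (P x y * q x u)) ->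
  exists (enc : X -> 'I_M -> R) (dec : 'I_M -> Y -> Z -> R),
    [/\ channel enc, forall m, channel (dec m) &
     \rsum_(x : X) \rsum_(y : Y) \rsum_(z : Z)
       Rabs (P x y * (\rsum_(m : 'I_M) (enc x m * dec m y z)) - jointXYZ P q W x y z)
     <= 2 * (k + 2 * \rsum_(x : X) \rsum_(y : Y) \rsum_(z : Z)
                \rsum_(u | ~~ ok x y z u) joint P q W x y z u)
        + 2 * (\rsum_(x : X) \rsum_(y : Y) \rsum_(u | ~~ good y u) (P x y * q x u)
               + / tau / (INR M * INR L))].
Proof.
move=> hok s0 k0 hk tau0 hgood.
have L0 : 0 < INR L by apply: lt_0_INR; apply/ltP.
have M0 : 0 < INR M by apply: lt_0_INR; apply/ltP.
have hV : (0 < #|V|)%N by rewrite card_prod !card_ord muln_gt0 hM.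
have hl := hashlaw_pmf U hV.
have p0 x y : 0 <= P x y by case: hP.
have q0 x u : 0 <= q x u by case: (hq x).
set A := \rsum_(x : X) \rsum_(y : Y) \rsum_(z : Z) _.
set B := \rsum_(x : X) \rsum_(y : Y) \rsum_(u | _) _.
pose C b := \rsum_(x : X) \rsum_(y : Y) \rsum_(z : Z) \rsum_(f : 'I_L) Rabs (bias b x y z f).
pose E b := \rsum_(x : X) \rsum_(y : Y) \rsum_(u | bin_err b y u) (P x y * q x u).
have sP : \rsum_(y : Y) \rsum_(x : X) P x y = 1 by rewrite exchange_big; case: hP.
have hC : \rsum_(b : {ffun U -> V}) (hashlaw b * C b) <= k + 2 * A.
  have -> : k + 2 * A = \rsum_(x : X) \rsum_(y : Y) \rsum_(z : Z)
     (k * T x y z + 2 * \rsum_(u | ~~ ok x y z u) J x y z u).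
    rewrite (eq_bigr (fun x => k * (\rsum_(y : Y) P x y) + 2 * \rsum_(y : Y) \rsum_(z : Z)
      \rsum_(u | ~~ ok x y z u) J x y z u)) => [|x _].
      rewrite rsumD !rsumZl (proj2 hP); congr (_ + _); by rewrite Rmult_1_r.
    rewrite -!rsumZl -rsumD; apply: eq_bigr => y _.
    by rewrite rsumD rsumZl jointXYZ_sumZ rsumZl.
  rewrite /C (eq_bigr (fun b => \rsum_(x : X) \rsum_(y : Y) \rsum_(z : Z)
     (hashlaw b * \rsum_(f : 'I_L) Rabs (bias b x y z f)))) => [|b _]; last first.
    by rewrite -rsumZl; apply: eq_bigr => x _; rewrite -rsumZl; apply: eq_bigr => y _; rewrite -rsumZl.
  rewrite exchange_big; apply: rsum_le => x _ /=.
  rewrite exchange_big; apply: rsum_le => y _ /=.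
  rewrite exchange_big; apply: rsum_le => z _ /=.
  apply: (@bin_uniform U M L hM hL (J x y z) (ok x y z) s k) => // [u|u].
    exact: joint_ge0.
  exact: hok.
have hE : \rsum_(b : {ffun U -> V}) (hashlaw b * E b) <= B + / tau / (INR M * INR L).
  pose coll b u y := \rsum_(u' | good y u' && (u' != u)) (if b u' == b u then 1 else 0).
  have coll0 b u y : 0 <= coll b u y by apply: rsum_ge0 => u' _; case: ifP => _; lra.
  (* Bob fails only if [u] is not good or another good letter has the same hash value. *)
  have herr b y u : (if bin_err b y u then 1 else 0) <=
      (if ~~ good y u then 1 else 0) + coll b u y.
    rewrite /bin_err /bin_guess; case: pickP => [u' /andP[/eqP bu gu]|h]; last first.
      by have := h u; rewrite -surjective_pairing eqxx => /= -> /=; have := coll0 b u y; lra.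
    case: eqP => [_|ne] /=.
      by have := coll0 b u y; case: ifP => _; lra.
    suff : 1 <= coll b u y by case: ifP => _; lra.
    have := @rsum_ge_term _ (fun u' => good y u' && (u' != u))
       (fun u' => if b u' == b u then 1 else 0) u'.
    rewrite bu -surjective_pairing eqxx; apply; first by move=> i _; case: ifP => _; lra.
    by rewrite gu; apply/eqP => e; apply: ne; rewrite e.
  apply: (Rle_trans _ (\rsum_(b : {ffun U -> V}) (hashlaw b * B +
     \rsum_(x : X) \rsum_(y : Y) \rsum_(u : U) (P x y * q x u * (hashlaw b * coll b u y))))).
    apply: rsum_le => b _; have hb := proj1 hl b.
    rewrite (eq_bigr (fun x => hashlaw b * \rsum_(y : Y) \rsum_(u : U)
      (P x y * q x u * coll b u y))) => [|x _]; last first.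
      rewrite -rsumZl; apply: eq_bigr => y _; rewrite -rsumZl; apply: eq_bigr => u _; ring.
    rewrite rsumZl -Rmult_plus_distr_l; apply: Rmult_le_compat_l => //.
    rewrite /B -rsumD; apply: rsum_le => x _; rewrite -rsumD; apply: rsum_le => y _.
    rewrite -(rsum_if (bin_err b y)) -(rsum_if (fun u => ~~ good y u)) -rsumD.
    apply: rsum_le => u _; have pq := Rmult_le_pos _ _ (p0 x y) (q0 x u).
    have := Rmult_le_compat_l _ _ _ pq (herr b y u).
    by case: ifP => _; case: ifP => _; nra.
  rewrite rsumD rsumZr (proj2 hl) Rmult_1_l; apply: Rplus_le_compat_l.
  pose N y : R := INR #|good y|.
  apply: (Rle_trans _ (\rsum_(y : Y) \rsum_(x : X) (P x y * (N y / (INR M * INR L))))).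
    rewrite exchange_big [X in _ <= X]exchange_big /=; apply: rsum_le => x _.
    rewrite exchange_big; apply: rsum_le => y _ /=.
    rewrite exchange_big /=.
    have -> : P x y * (N y / (INR M * INR L)) =
       \rsum_(u : U) (P x y * q x u * (N y / (INR M * INR L))).
      by rewrite rsumZr rsumZl (proj2 (hq x)) Rmult_1_r.
    apply: rsum_le => u _; rewrite rsumZl; apply: Rmult_le_compat_l.
      exact: Rmult_le_pos.
    exact: (bin_collision hM hL).
  rewrite -[X in _ <= X]Rmult_1_l -sP -rsumZr; apply: rsum_le => y _.
  rewrite rsumZr /Rdiv -!Rmult_assoc; apply: Rmult_le_compat_r.
    by apply/Rlt_le/Rinv_0_lt_compat/Rmult_lt_0_compat.
  (* For [y] of positive mass there are at most [/ tau] good letters, because each has conditional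
     weight at least [tau]. *)
  apply: (Rmult_le_reg_l tau) => //.
  have -> : tau * ((\rsum_(x : X) P x y) * / tau) = \rsum_(x : X) P x y by field; lra.
  have -> : tau * ((\rsum_(x : X) P x y) * N y) = N y * (tau * \rsum_(x : X) P x y) by ring.
  rewrite -rsum_count; apply: (Rle_trans _ (\rsum_(u | good y u) \rsum_(x : X) (P x y * q x u))).
    by apply: rsum_le => u; apply: hgood.
  apply: (Rle_trans _ (\rsum_(u : U) \rsum_(x : X) (P x y * q x u))).
    apply: rsum_subpred => // u; apply: rsum_ge0 => x _; exact: Rmult_le_pos.
  rewrite exchange_big /=; apply: Req_le; apply: eq_bigr => x _.
  by rewrite rsumZl (proj2 (hq x)) Rmult_1_r.
pose F b f := \rsum_(x : X) \rsum_(y : Y) \rsum_(z : Z)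
   Rabs (P x y * (\rsum_(m : 'I_M) (bin_enc b f x m * bin_dec b f m y z)) - T x y z).
have hF b : \rsum_(f : 'I_L) (/ INR L * F b f) <= 2 * C b + 2 * E b.
  rewrite /F (eq_bigr (fun f => \rsum_(x : X) \rsum_(y : Y) \rsum_(z : Z) Rabs
      (P x y * (\rsum_(m : 'I_M) (bin_enc b f x m * bin_dec b f m y z)) / INR L
        - T x y z / INR L))) => [|f _]; last first.
    rewrite -rsumZl; apply: eq_bigr => x _; rewrite -rsumZl; apply: eq_bigr => y _.
    rewrite -rsumZl; apply: eq_bigr => z _; rewrite Rmult_comm Rabs_scale //.
    by congr Rabs; rewrite /Rdiv; ring.
  rewrite exchange_big /C /E -!rsumZl -rsumD; apply: rsum_le => x _ /=.
  rewrite exchange_big -!rsumZl -rsumD; apply: rsum_le => y _ /=.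
  by rewrite exchange_big; apply: binning_pointwise.
have [b hb] : exists b, \rsum_(f : 'I_L) (/ INR L * F b f)
    <= 2 * (k + 2 * A) + 2 * (B + / tau / (INR M * INR L)).
  apply: (pmf_exists_le hl).
  apply: (Rle_trans _ (\rsum_(b : {ffun U -> V}) (2 * (hashlaw b * C b) + 2 * (hashlaw b * E b)))).
    apply: rsum_le => b _.
    by have := Rmult_le_compat_l _ _ _ (proj1 hl b) (hF b); lra.
  by rewrite rsumD (rsumZl _ 2) (rsumZl _ 2); apply: Rplus_le_compat; apply: Rmult_le_compat_l => //; lra.
have uL : pmf (fun _ : 'I_L => / INR L).
  by have := @unif_pmf 'I_L; rewrite card_ord; apply.
have [f hf] := pmf_exists_le uL hb.
exists (bin_enc b f), (bin_dec b f); split=> //; first exact: bin_enc_channel.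
exact: bin_dec_channel.
Qed.

End OneShot.

(** * Block laws and achievability *)

Lemma rsum_ffun_zip (I A B : finType) (H : {ffun I -> A} -> {ffun I -> B} -> R) :
  \rsum_(a : {ffun I -> A}) \rsum_(b : {ffun I -> B}) H a b
  = \rsum_(f : {ffun I -> A * B}) H [ffun i => (f i).1] [ffun i => (f i).2].
Proof.
rewrite pair_bigA (rsum_reindex (f := fun f : {ffun I -> A * B} =>
  ([ffun i => (f i).1], [ffun i => (f i).2])) (g := fun p => [ffun i => (p.1 i, p.2 i)])) //.
  by move=> f; apply/ffunP => i; rewrite !ffunE; case: (f i).
by case=> a b; congr pair; apply/ffunP => i; rewrite !ffunE.
Qed.

Lemma rsum_ffun_zip3 (I A B C : finType)
  (H : {ffun I -> A} -> {ffun I -> B} -> {ffun I -> C} -> R) :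
  \rsum_(a : {ffun I -> A}) \rsum_(b : {ffun I -> B}) \rsum_(c : {ffun I -> C}) H a b c
  = \rsum_(f : {ffun I -> A * B * C})
      H [ffun i => (f i).1.1] [ffun i => (f i).1.2] [ffun i => (f i).2].
Proof.
rewrite (rsum_ffun_zip (fun a b => \rsum_(c : {ffun I -> C}) H a b c)).
rewrite (rsum_ffun_zip (fun (f : {ffun I -> A * B}) c =>
  H [ffun i => (f i).1] [ffun i => (f i).2] c)).
apply: eq_bigr => f _.
by congr H; apply/ffunP => i; rewrite !ffunE.
Qed.

Lemma rsum_ffun_zip4 (I A B C D : finType)
  (H : {ffun I -> A} -> {ffun I -> B} -> {ffun I -> C} -> {ffun I -> D} -> R) :
  \rsum_(a : {ffun I -> A}) \rsum_(b : {ffun I -> B}) \rsum_(c : {ffun I -> C})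
     \rsum_(d : {ffun I -> D}) H a b c d
  = \rsum_(f : {ffun I -> A * B * C * D})
      H [ffun i => (f i).1.1.1] [ffun i => (f i).1.1.2] [ffun i => (f i).1.2] [ffun i => (f i).2].
Proof.
rewrite (rsum_ffun_zip3 (fun a b c => \rsum_(d : {ffun I -> D}) H a b c d)).
rewrite (rsum_ffun_zip (fun (f : {ffun I -> A * B * C}) d =>
  H [ffun i => (f i).1.1] [ffun i => (f i).1.2] [ffun i => (f i).2] d)).
apply: eq_bigr => f _.
by congr H; apply/ffunP => i; rewrite !ffunE.
Qed.

Section LnProd.
Variables (I : finType) (F : I -> R).

Lemma ln_rprod : (forall i, 0 < F i) ->
  ln (\big[Rmult/R1]_(i : I) F i) = \rsum_(i : I) ln (F i).
Proof.
move=> h; suff [] : 0 < \big[Rmult/R1]_(i : I) F i /\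
  ln (\big[Rmult/R1]_(i : I) F i) = \rsum_(i : I) ln (F i) by [].
elim/big_rec2: _ => [|i x y _ [y0 e]]; first by split; [lra | exact: ln_1].
split; first exact: Rmult_lt_0_compat.
by rewrite ln_mult // e.
Qed.

Lemma rprod_gt0_inv : (forall i, 0 <= F i) -> 0 < \big[Rmult/R1]_(i : I) F i ->
  forall i, 0 < F i.
Proof.
move=> h p0 i; case: (h i) => // e.
by move: p0; rewrite (bigD1 i) //= -e Rmult_0_l; lra.
Qed.

End LnProd.

Section MutualInfo.
Variables (X Y Z U : finType) (P : X -> Y -> R) (q : X -> U -> R) (W : U -> Y -> Z -> R).

Definition margY (y : Y) : R := \rsum_(x : X) P x y.
Definition margYU (y : Y) (u : U) : R := \rsum_(x : X) (P x y * q x u).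

(* I(X,Z;U|Y), in nats. *)
Definition mutinf : R :=
  \rsum_(x : X) \rsum_(y : Y) \rsum_(z : Z) \rsum_(u : U)
    (joint P q W x y z u * ln (joint P q W x y z u * margY y
                               / (margYU y u * jointXYZ P q W x y z))).

Hypotheses (hP : pmf2 P) (hq : channel q) (hW : forall u, channel (W u)).

Lemma margY_ge0 y : 0 <= margY y.
Proof. by apply: rsum_ge0 => x _; case: hP. Qed.

Lemma margYU_ge0 y u : 0 <= margYU y u.
Proof. by apply: rsum_ge0 => x _; apply: Rmult_le_pos; [case: hP | case: (hq x)]. Qed.

Lemma joint_pos x y z u : 0 < joint P q W x y z u ->
  [/\ 0 < margY y, 0 < margYU y u & 0 < jointXYZ P q W x y z].
Proof.
move=> h; have p0 x' : 0 <= P x' y by case: hP.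
have q0 x' : 0 <= q x' u by case: (hq x').
have w0 : 0 <= W u y z by case: (hW u y).
have pp : 0 < P x y.
  case: (p0 x) => // e; move: h; rewrite /joint -e !Rmult_0_l; lra.
have qp : 0 < q x u.
  case: (q0 x) => // e; move: h; rewrite /joint -e Rmult_0_r Rmult_0_l; lra.
split.
- by apply: Rlt_le_trans pp _; apply: (rsum_ge_term (P := xpredT)).
- apply: (Rlt_le_trans _ (P x y * q x u)); first exact: Rmult_lt_0_compat.
  apply: (@rsum_ge_term _ xpredT (fun x => P x y * q x u)) => // x' _; exact: Rmult_le_pos.
- apply: (Rlt_le_trans _ _ _ h); apply: (@rsum_ge_term _ xpredT (fun u => joint P q W x y z u)) => // u' _.
  exact: joint_ge0.
Qed.

End MutualInfo.

(** * Memoryless extension to blocks *)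

Section BlockLaws.
Variables (X Y Z U : finType) (P : X -> Y -> R) (q : X -> U -> R) (W : U -> Y -> Z -> R).
Hypotheses (hP : pmf2 P) (hq : channel q) (hW : forall u, channel (W u)).
Variable n : nat.

Definition blockq (x : seqn n X) (u : seqn n U) : R := \rprod_(i < n) q (x i) (u i).
Definition blockW (u : seqn n U) (y : seqn n Y) (z : seqn n Z) : R :=
  \rprod_(i < n) W (u i) (y i) (z i).

Lemma pXYn_pmf2 : pmf2 (@pXYn X Y P n).
Proof.
split=> [x y|]; first by apply: rprod_ge0 => i _; case: hP.
rewrite (eq_bigr (fun x : seqn n X => \rprod_(i < n) \rsum_(y : Y) P (x i) y)) => [|x _].
  rewrite (rsum_ffun_prod (fun _ x => \rsum_(y : Y) P x y)) big1 // => i _; by case: hP.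
by rewrite -(rsum_ffun_prod (fun i y => P (x i) y)).
Qed.

Lemma blockq_channel : channel blockq.
Proof.
move=> x; split=> [u|]; first by apply: rprod_ge0 => i _; case: (hq (x i)).
by rewrite (rsum_ffun_prod (fun i u => q (x i) u)) big1 // => i _; case: (hq (x i)).
Qed.

Lemma blockW_channel u : channel (blockW u).
Proof.
move=> y; split=> [z|]; first by apply: rprod_ge0 => i _; case: (hW (u i) (y i)).
by rewrite (rsum_ffun_prod (fun i z => W (u i) (y i) z)) big1 // => i _; case: (hW (u i) (y i)).
Qed.

Lemma block_joint x y z u : joint (@pXYn X Y P n) blockq blockW x y z u
  = \rprod_(i < n) joint P q W (x i) (y i) (z i) (u i).
Proof. by rewrite /joint /pXYn /blockq /blockW -!big_split. Qed.

Lemma block_jointXYZ x y z : jointXYZ (@pXYn X Y P n) blockq blockW x y z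
  = \rprod_(i < n) jointXYZ P q W (x i) (y i) (z i).
Proof.
rewrite /jointXYZ -(rsum_ffun_prod (fun i u => joint P q W (x i) (y i) (z i) u)).
by apply: eq_bigr => u _; rewrite block_joint.
Qed.

Lemma block_margY y : margY (@pXYn X Y P n) y = \rprod_(i < n) margY P (y i).
Proof. by rewrite /margY -(rsum_ffun_prod (fun i x => P x (y i))). Qed.

Lemma block_margYU y u : margYU (@pXYn X Y P n) blockq y u = \rprod_(i < n) margYU P q (y i) (u i).
Proof.
rewrite /margYU -(rsum_ffun_prod (fun i x => P x (y i) * q x (u i))).
by apply: eq_bigr => x _; rewrite /pXYn /blockq -big_split.
Qed.

Definition letterlaw (a : X * Y * Z * U) : R := joint P q W a.1.1.1 a.1.1.2 a.1.2 a.2.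

Lemma letterlaw_pmf : pmf letterlaw.
Proof.
split=> [a|]; first exact: joint_ge0.
rewrite /letterlaw rsum_pair rsum_pair rsum_pair /= -(proj2 hP).
apply: eq_bigr => x _; apply: eq_bigr => y _.
exact: (jointXYZ_sumZ P hq hW).
Qed.

(* Chebyshev on the i.i.d. letters, transported to the sum over the four blocks. *)
Lemma block_weak_law (g : X * Y * Z * U -> R) (bad : seqn n X -> seqn n Y -> seqn n Z -> pred (seqn n U))
    (d mu : R) :
  (0 < n)%N -> 0 < d -> mu = \rsum_(a : X * Y * Z * U) (letterlaw a * g a) ->
  (forall x y z u, bad x y z u ->
     (forall i, 0 < joint P q W (x i) (y i) (z i) (u i)) ->
     INR n * d <= Rabs (\rsum_(i : 'I_n) g (x i, y i, z i, u i) - INR n * mu)) ->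
  \rsum_(x : seqn n X) \rsum_(y : seqn n Y) \rsum_(z : seqn n Z) \rsum_(u | bad x y z u)
    joint (@pXYn X Y P n) blockq blockW x y z u
  <= (\rsum_(a : X * Y * Z * U) (letterlaw a * (g a - mu) ^ 2)) / d ^ 2 / INR n.
Proof.
move=> n0 d0 -> hbad.
rewrite (eq_bigr (fun x : seqn n X => \rsum_(y : seqn n Y) \rsum_(z : seqn n Z) \rsum_(u : seqn n U)
   if bad x y z u then \rprod_(i < n) joint P q W (x i) (y i) (z i) (u i) else 0)); last first.
  move=> x _; apply: eq_bigr => y _; apply: eq_bigr => z _.
  rewrite -(rsum_if (bad x y z)); apply: eq_bigr => u _; by rewrite block_joint.
rewrite (rsum_ffun_zip4 (fun x y z u => if bad x y z u then
   \rprod_(i < n) joint P q W (x i) (y i) (z i) (u i) else 0)).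
set bad' := fun f : {ffun 'I_n -> X * Y * Z * U} => bad [ffun i => (f i).1.1.1]
   [ffun i => (f i).1.1.2] [ffun i => (f i).1.2] [ffun i => (f i).2].
rewrite (eq_bigr (fun f : {ffun 'I_n -> X * Y * Z * U} => if bad' f then prodlaw letterlaw f else 0)).
  rewrite (rsum_if bad'); apply: weak_law => //; first exact: letterlaw_pmf.
  move=> f /hbad h /rprod_gt0_inv pos; set mu' := \rsum_(a : _) _.
  rewrite (eq_bigr (fun i => g ([ffun i => (f i).1.1.1] i, [ffun i => (f i).1.1.2] i,
     [ffun i => (f i).1.2] i, [ffun i => (f i).2] i))) => [|i _]; last first.
    by rewrite !ffunE; case: (f i) => [[[]]].
  apply: h => i; rewrite !ffunE; apply: pos => j; exact: joint_ge0.
move=> f _; rewrite /bad'; case: ifP => // _; apply: eq_bigr => i _; by rewrite !ffunE.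
Qed.

End BlockLaws.

Lemma nat_floor (x : R) : 0 <= x -> exists k : nat, INR k <= x < INR k + 1.
Proof.
move=> x0; have [h1 h2] := archimed x.
have hz : (0 <= up x - 1)%Z.
  have : (0 < up x)%Z by apply: lt_IZR; lra.
  lia.
exists (Z.to_nat (up x - 1)).
by rewrite INR_IZR_INZ Z2Nat.id // minus_IZR; lra.
Qed.

Lemma exp_neg_le (x : R) : 0 < x -> exp (- x) <= / x.
Proof.
move=> x0; rewrite exp_Ropp; apply: Rinv_le_contravar => //.
have := exp_ineq1_le x; lra.
Qed.

Lemma lt_ln_exp (a b c : R) : 0 < b -> 0 < c -> exp a * b < c -> a < ln c - ln b.
Proof.
move=> b0 c0 /(ln_increasing _ _ (Rmult_lt_0_compat _ _ (exp_pos a) b0)).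
rewrite ln_mult //; last exact: exp_pos.
rewrite ln_exp; lra.
Qed.

Definition Rleb (x y : R) : bool := if Rle_dec x y then true else false.
Lemma RlebP (x y : R) : reflect (x <= y) (Rleb x y).
Proof. by rewrite /Rleb; case: Rle_dec => h; constructor. Qed.

(** * Codes at every rate above the information *)

Section Achievability.
Variables (X Y Z U : finType) (P : X -> Y -> R) (q : X -> U -> R) (W : U -> Y -> Z -> R).
Hypotheses (hP : pmf2 P) (hq : channel q) (hW : forall u, channel (W u)).
Let J := joint P q W.
Let T := jointXYZ P q W.
Let lawJ := letterlaw P q W.

Let gF (a : X * Y * Z * U) := ln (T a.1.1.1 a.1.1.2 a.1.2) - ln (J a.1.1.1 a.1.1.2 a.1.2 a.2).
Let gD (a : X * Y * Z * U) := ln (margY P a.1.1.2) - ln (margYU P q a.1.1.2 a.2).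

(* [gF] and [gD] have means H(U|X,Y,Z) and H(U|Y). *)
Lemma mutinf_letter : mutinf P q W
  = \rsum_(a : X * Y * Z * U) (lawJ a * gD a) - \rsum_(a : X * Y * Z * U) (lawJ a * gF a).
Proof.
rewrite -rsumB rsum_pair rsum_pair rsum_pair; apply: eq_bigr => x _; apply: eq_bigr => y _.
apply: eq_bigr => z _; apply: eq_bigr => u _.
rewrite /lawJ /letterlaw /gF /gD /J /T /=.
case: (joint_ge0 hP hq hW x y z u) => [h|<-]; last by rewrite !Rmult_0_l; ring.
have [h1 h2 h3] := joint_pos hP hq hW h; move: (joint P q W x y z u) h => j h.
rewrite -Rmult_minus_distr_l; congr (_ * _).
rewrite /Rdiv ln_mult; [|exact: Rmult_lt_0_compat|by apply/Rinv_0_lt_compat/Rmult_lt_0_compat].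
rewrite ln_Rinv; last exact: Rmult_lt_0_compat.
by rewrite !ln_mult //; lra.
Qed.

Lemma channel_target_inhab : inhabited U.
Proof.
have [x] := pmf2_inhab hP; constructor; exact: (pmf_inhab (hq x)).
Qed.

(** Every error term is of order 1/n: atypical blocks by Chebyshev's inequality, the exponentially
    small terms by [exp_neg_le]. *)
Lemma achievability_bound (r : R) : 0 <= r -> mutinf P q W < r ->
  exists C : R, forall n : nat, (0 < n)%N ->
    exists (m : nat) (c : code X Y Z n m),
      [/\ valid_code c, INR m <= exp (INR n * r) &
       \rsum_(x : seqn n X) \rsum_(y : seqn n Y) \rsum_(z : seqn n Z)
         Rabs (induced P c x y z - \rprod_(i < n) T (x i) (y i) (z i)) <= C / INR n].
Proof.
move=> r0; rewrite mutinf_letter.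
set k := \rsum_(a : _) (lawJ a * gD a); set h := \rsum_(a : _) (lawJ a * gF a) => hr.
(* The gap [4 * d] is spent as follows: one [d] on the threshold [s], one on [tau], one to make L
   times [s] about [exp (- (N * d))], and the last to make [/ tau / (M * L)] about as small. *)
pose d := (r - (k - h)) / 4; have d0 : 0 < d by rewrite /d; lra.
pose V1 := \rsum_(a : X * Y * Z * U) (lawJ a * (gF a - h) ^ 2).
pose V2 := \rsum_(a : X * Y * Z * U) (lawJ a * (gD a - k) ^ 2).
exists (8 / d + 4 * (V1 / d ^ 2) + 2 * (V2 / d ^ 2)) => n hn.
have n0 : 0 < INR n by apply: lt_0_INR; apply/ltP.
set N := INR n in n0 *.
(* There will be [l.+1] indices: rounding up keeps their number above the exponential, as decoding
   requires, while the [INR L - 1] of the uniformity condition stays below it. *)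
have [l [l1 l2]] := nat_floor (Rlt_le _ _ (exp_pos (N * (h - 2 * d)))).
have [M [M1 M2]] := nat_floor (Rlt_le _ _ (exp_pos (N * r))).
have e1 : 1 <= exp (N * r).
  by have := exp_ineq1_le (N * r); have := Rmult_le_pos _ _ (Rlt_le _ _ n0) r0; lra.
have M0 : (0 < M)%N by apply/ltP; apply: INR_lt => /=; lra.
have M1' : 1 <= INR M by apply: (le_INR 1); apply/leP.
pose s := exp (- (N * (h - d))); pose tau := exp (- (N * (k + d))).
pose kap := exp (- (N * d / 2)).
have s0 : 0 < s by apply: exp_pos.
have tau0 : 0 < tau by apply: exp_pos.
pose Pn := @pXYn X Y P n; pose qn := @blockq X U q n; pose Wn := @blockW Y Z U W n.
have hPn : pmf2 Pn by apply: pXYn_pmf2.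
have hqn : channel qn by apply: blockq_channel.
have hWn u : channel (Wn u) by apply: blockW_channel.
pose ok x y z : pred (seqn n U) := fun u => Rleb (joint Pn qn Wn x y z u) (s * jointXYZ Pn qn Wn x y z).
pose good y : pred (seqn n U) := fun u => Rleb (tau * margY Pn y) (margYU Pn qn y u).
have [u1] := channel_target_inhab.
have hok x y z u : ok x y z u -> joint Pn qn Wn x y z u <= s * jointXYZ Pn qn Wn x y z by move/RlebP.
have hgood y u : good y u -> tau * (\rsum_(x : seqn n X) Pn x y) <= \rsum_(x : seqn n X) (Pn x y * qn x u).
  by move/RlebP.
have hks : (INR l.+1 - 1) * s <= kap ^ 2.
  have -> : kap ^ 2 = exp (N * (h - 2 * d)) * s.
    by rewrite /kap /s /= Rmult_1_r -!exp_plus; congr exp; field.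
  by rewrite S_INR; apply: Rmult_le_compat_r; lra.
have [enc [dec [henc hdec hb]]] := one_shot_simulation hPn hqn hWn M0 (ltn0Sn l) [ffun => u1]
  hok (Rlt_le _ _ s0) (exp_pos _) hks tau0 hgood.
exists M, (Code enc dec); split=> //.
rewrite /induced /=; under eq_bigr => x _ do under eq_bigr => y _ do under eq_bigr => z _ do
  rewrite -(block_jointXYZ P q W x y z).
apply: Rle_trans hb _.
have b1 : \rsum_(x : seqn n X) \rsum_(y : seqn n Y) \rsum_(z : seqn n Z)
   \rsum_(u | ~~ ok x y z u) joint Pn qn Wn x y z u <= V1 / d ^ 2 / N.
  apply: (@block_weak_law X Y Z U P q W hP hq hW n gF) => // x y z u.
  move=> /RlebP /Rnot_le_lt; rewrite block_joint block_jointXYZ => hlt pos.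
  have Tpos i : 0 < T (x i) (y i) (z i) by have [] := joint_pos hP hq hW (pos i).
  have := lt_ln_exp (rprod_gt0 (fun i _ => Tpos i)) (rprod_gt0 (fun i _ => pos i)) hlt.
  rewrite !ln_rprod // -/N => hlt'.
  rewrite /gF /= rsumB -Rabs_Ropp; apply: Rle_trans (Rle_abs _).
  rewrite /J /T; rewrite /T in hlt'; rewrite -/N; lra.
have b2 : \rsum_(x : seqn n X) \rsum_(y : seqn n Y) \rsum_(u | ~~ good y u) (Pn x y * qn x u)
   <= V2 / d ^ 2 / N.
  rewrite (eq_bigr (fun x => \rsum_(y : seqn n Y) \rsum_(z : seqn n Z)
     \rsum_(u | ~~ good y u) joint Pn qn Wn x y z u)) => [|x _]; last first.
    apply: eq_bigr => y _; rewrite exchange_big /=; apply: eq_bigr => u _.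
    by rewrite joint_sumZ.
  apply: (@block_weak_law X Y Z U P q W hP hq hW n gD (fun x y z u => ~~ good y u)) => // x y z u.
  move=> /RlebP /Rnot_le_lt; rewrite block_margY block_margYU => hlt pos.
  have Ypos i : 0 < margY P (y i) by have [] := joint_pos hP hq hW (pos i).
  have YUpos i : 0 < margYU P q (y i) (u i) by have [] := joint_pos hP hq hW (pos i).
  have h1 : ln (\rprod_(i < n) margYU P q (y i) (u i)) <
     ln (tau * \rprod_(i < n) margY P (y i)).
    by apply: ln_increasing => //; apply: rprod_gt0.
  rewrite ln_mult // in h1; last by apply: rprod_gt0.
  rewrite /tau ln_exp !ln_rprod // -/N in h1.
  rewrite /gD /= rsumB; apply: Rle_trans (Rle_abs _).
  by rewrite -/N; lra.
have b3 : kap <= 2 / d / N.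
  have -> : 2 / d / N = / (N * d / 2) by field; lra.
  apply: exp_neg_le; have := Rmult_lt_0_compat _ _ n0 d0; lra.
have b4 : / tau / (INR M * INR l.+1) <= 2 / d / N.
  have L0 : 0 < INR l.+1 by apply: lt_0_INR; apply/ltP.
  (* Rounding the number of messages down costs at most a factor 2, since [exp (N * r)] is at least
     1. *)
  have hML : exp (N * r) / 2 * exp (N * (h - 2 * d)) <= INR M * INR l.+1.
    rewrite S_INR; apply: Rmult_le_compat; try lra.
    exact/Rlt_le/exp_pos.
  have hnd : exp (- (N * d)) <= / (N * d) by apply: exp_neg_le; apply: Rmult_lt_0_compat.
  have -> : 2 / d / N = 2 * / (N * d) by field; lra.
  apply: (Rle_trans _ (2 * exp (- (N * d)))); last lra.
  have hp := Rmult_lt_0_compat _ _ (exp_pos (N * r)) (exp_pos (N * (h - 2 * d))).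
  apply: (Rle_trans _ (/ tau / (exp (N * r) / 2 * exp (N * (h - 2 * d))))).
    apply: Rmult_le_compat_l; first exact/Rlt_le/Rinv_0_lt_compat.
    by apply: Rinv_le_contravar => //; lra.
  apply: Req_le; rewrite /tau -exp_Ropp Ropp_involutive.
  have -> : N * (k + d) = - (N * d) + N * r + N * (h - 2 * d) by rewrite /d; field.
  rewrite !exp_plus; field; split; apply: Rgt_not_eq; exact: exp_pos.
have -> : (8 / d + 4 * (V1 / d ^ 2) + 2 * (V2 / d ^ 2)) / N =
  2 * (2 / d / N + 2 * (V1 / d ^ 2 / N)) + 2 * (V2 / d ^ 2 / N + 2 / d / N) by field; lra.
apply: Rplus_le_compat; apply: Rmult_le_compat_l; try lra; apply: Rplus_le_compat => //.
by apply: Rmult_le_compat_l; [lra | exact: b1].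
Qed.

End Achievability.

(** * Entropy and single-letterization *)

Definition eta (x : R) : R := - (x * ln x).

Lemma eta0 : eta 0 = 0. Proof. by rewrite /eta; ring. Qed.

Lemma ln_le_sub1 (x : R) : 0 < x -> ln x <= x - 1.
Proof.
move=> x0; have := exp_ineq1_le (ln x); rewrite exp_ln //; lra.
Qed.

Lemma ln_le (x y : R) : 0 < x -> x <= y -> ln x <= ln y.
Proof.
by move=> x0 [xy|->]; [apply/Rlt_le/ln_increasing | apply: Rle_refl].
Qed.

Lemma eta_le1 (x : R) : 0 <= x -> eta x <= 1.
Proof.
case=> [x0|<-]; last by rewrite eta0; lra.
have h := ln_le_sub1 (Rinv_0_lt_compat _ x0); rewrite ln_Rinv // in h.
have := Rmult_le_compat_l _ _ _ (Rlt_le _ _ x0) h.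
by rewrite /eta Rmult_minus_distr_l Rinv_r; lra.
Qed.

Lemma eta_subadd (a b : R) : 0 <= a -> 0 <= b -> eta (a + b) <= eta a + eta b.
Proof.
case=> [a0|<-]; last by rewrite eta0 Rplus_0_l; lra.
case=> [b0|<-]; last by rewrite eta0 !Rplus_0_r; lra.
have h1 : ln a <= ln (a + b) by apply: ln_le => //; lra.
have h2 : ln b <= ln (a + b) by apply: ln_le => //; lra.
by rewrite /eta; nra.
Qed.

(** Merging atoms does not raise the entropy; the converse uses this to discard the message from the
    block law. *)
Lemma eta_rsum (T : finType) (P : pred T) (F : T -> R) : (forall i, 0 <= F i) ->
  eta (\rsum_(i | P i) F i) <= \rsum_(i | P i) eta (F i).
Proof.
move=> F0; suff [] : 0 <= \rsum_(i | P i) F i /\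
  eta (\rsum_(i | P i) F i) <= \rsum_(i | P i) eta (F i) by [].
elim/big_rec2: _ => [|i x y _ [y0 e]]; first by rewrite eta0; lra.
split; first by have := F0 i; lra.
by have := eta_subadd (F0 i) y0; lra.
Qed.

(** Follows from [ln x <= x - 1]. Comparing total masses admits a [Q] that loses mass on null
    conditionals, as happens in the converse. *)
Lemma gibbs (T : finType) (P Q : T -> R) : (forall i, 0 <= P i) -> (forall i, 0 <= Q i) ->
  (forall i, 0 < P i -> 0 < Q i) -> \rsum_(i : T) Q i <= \rsum_(i : T) P i ->
  \rsum_(i : T) (P i * ln (Q i)) <= \rsum_(i : T) (P i * ln (P i)).
Proof.
move=> P0 Q0 PQ hs.
suff : \rsum_(i : T) (P i * ln (Q i) - P i * ln (P i)) <= \rsum_(i : T) (Q i - P i).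
  by rewrite !rsumB; lra.
apply: rsum_le => i _; case: (P0 i) => [p0|<-]; last by have := Q0 i; lra.
have q0 := PQ _ p0.
have h := ln_le_sub1 (Rdiv_lt_0_compat _ _ q0 p0).
rewrite /Rdiv ln_mult ?ln_Rinv // in h; last exact: Rinv_0_lt_compat.
have := Rmult_le_compat_l _ _ _ (Rlt_le _ _ p0) h.
have -> : P i * (Q i * / P i - 1) = Q i - P i by field; lra.
lra.
Qed.

(** A Fannes-type bound. With [m] the pointwise minimum, [q = m + d] and [p = m + d']. Going from
    [q] to [m] costs at most [eta (d a)] by subadditivity, and from [m] to [p] at most [d' a], since
    [eta] has slope at least -1 on the unit interval. The bound is crude but linear in
    [ln (INR #|A|)]: on blocks of length n it is n times a small number plus a constant, which
    disappears after division by n. *)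
Lemma entropy_perturb (A : finType) (p q : A -> R) (a0 : A) :
  pmf p -> pmf q ->
  \rsum_(a : A) eta (q a) <= \rsum_(a : A) eta (p a)
    + (\rsum_(a : A) Rabs (p a - q a)) * (1 + ln (INR #|A|)) + 1.
Proof.
move=> [p0 p1] [q0 q1].
pose d a := Rmax (q a - p a) 0; pose d' a := Rmax (p a - q a) 0.
have d0 a : 0 <= d a by apply: Rmax_r.
have d'0 a : 0 <= d' a by apply: Rmax_r.
have dle a : d a <= Rabs (p a - q a).
  by rewrite /d; apply: Rmax_lub; [rewrite Rabs_minus_sym; apply: Rle_abs | apply: Rabs_pos].
have d'le a : d' a <= Rabs (p a - q a).
  by rewrite /d'; apply: Rmax_lub; [apply: Rle_abs | apply: Rabs_pos].
have ple a : p a <= 1.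
  by have := @rsum_ge_term _ xpredT p a (fun i _ => p0 i) isT; rewrite p1.
set D := \rsum_(a : A) d a.
set e := \rsum_(a : A) Rabs (p a - q a).
have D0 : 0 <= D by apply: rsum_ge0.
have De : D <= e by apply: rsum_le.
have pt a : eta (q a) <= eta (p a) + d' a + eta (d a).
  pose m := Rmin (q a) (p a).
  have m0 : 0 <= m by apply: Rmin_glb.
  have qE : q a = m + d a by rewrite /m /d /Rmin /Rmax; do 2 case: Rle_dec; lra.
  have pE : p a = m + d' a by rewrite /m /d' /Rmin /Rmax; do 2 case: Rle_dec; lra.
  have h1 : eta (q a) <= eta m + eta (d a) by rewrite qE; apply: eta_subadd.
  suff h2 : eta m - d' a <= eta (p a) by lra.
  case: m0 => [m0|m0]; last first.
    rewrite -m0 eta0 /eta.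
    case: (p0 a) => [pp|<-]; last by have := d'0 a; lra.
    have : ln (p a) <= 0 by rewrite -ln_1; apply: ln_le.
    by have := d'0 a; nra.
  have pp : 0 < p a by rewrite pE; have := d'0 a; lra.
  have l0 : ln (p a) <= 0 by rewrite -ln_1; apply: ln_le.
  have lm : ln (p a) <= ln m + d' a / m.
    have -> : p a = m * (1 + d' a / m) by rewrite pE; field; lra.
    have h3 : 0 <= d' a / m by apply: Rmult_le_pos => //; apply/Rlt_le/Rinv_0_lt_compat.
    rewrite ln_mult; [|lra|lra].
    by have := @ln_le_sub1 (1 + d' a / m); lra.
  have := Rmult_le_compat_l _ _ _ (Rlt_le _ _ m0) lm.
  have -> : m * (ln m + d' a / m) = m * ln m + d' a by field; lra.
  rewrite /eta => h3.
  have : p a * ln (p a) <= m * ln (p a) by rewrite {1}pE; have := d'0 a; nra.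
  lra.
have A0 : 1 <= INR #|A|.
  by apply: (le_INR 1); apply/leP/card_gt0P; exists a0.
have lA : 0 <= ln (INR #|A|) by rewrite -ln_1; apply: ln_le; lra.
(* Gibbs' inequality against the constant weight of total [D]; the remainder [eta D] is at most
   1. *)
have hd : \rsum_(a : A) eta (d a) <= D * ln (INR #|A|) + 1.
  case: D0 => [D0|D0]; last first.
    rewrite -D0 rsum0 => [|a _]; first lra.
    have := rsum_eq0 (fun i _ => d0 i) (esym D0) (isT : xpredT a) => ->; exact: eta0.
  have Q0 : 0 < D / INR #|A| by apply: Rdiv_lt_0_compat; lra.
  have := @gibbs A d (fun _ => D / INR #|A|) d0 (fun _ => Rlt_le _ _ Q0) (fun _ _ => Q0).
  rewrite rsum_const rsumZr -/D => /(_ ltac:(apply: Req_le; field; lra)).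
  rewrite /Rdiv ln_mult ?ln_Rinv; [|lra|lra|by apply: Rinv_0_lt_compat; lra].
  have := eta_le1 (Rlt_le _ _ D0); rewrite /eta rsumN; lra.
apply: Rle_trans (rsum_le (fun a _ => pt a)) _.
rewrite !rsumD.
have : \rsum_(a : A) d' a <= e by apply: rsum_le.
have := Rmult_le_compat_r _ _ _ lA De; lra.
Qed.

Lemma prodlaw_entropy (I A : finType) (p : A -> R) : pmf p ->
  \rsum_(f : {ffun I -> A}) eta (prodlaw p f) = INR #|I| * \rsum_(a : A) eta (p a).
Proof.
move=> hp; transitivity (\rsum_(f : {ffun I -> A}) \rsum_(i : I) (prodlaw p f * - ln (p (f i)))).
  apply: eq_bigr => f _; rewrite rsumZl rsumN /eta.
  case: (prodlaw_ge0 hp f) => [h|<-]; last by ring.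
  rewrite {2}/prodlaw ln_rprod; first by ring.
  by apply: rprod_gt0_inv h => i; case: hp.
rewrite exchange_big /= -rsum_const; apply: eq_bigr => i _.
rewrite (prodlaw_expect hp i (fun a => - ln (p a))); apply: eq_bigr => a _; rewrite /eta; ring.
Qed.

Section JointSums.
Variables (X Y Z U : finType) (P : X -> Y -> R) (q : X -> U -> R) (W : U -> Y -> Z -> R).
Hypotheses (hP : pmf2 P) (hq : channel q) (hW : forall u, channel (W u)).

Lemma joint_sumYU (phi : Y -> U -> R) :
  \rsum_(x : X) \rsum_(y : Y) \rsum_(z : Z) \rsum_(u : U) (joint P q W x y z u * phi y u)
  = \rsum_(y : Y) \rsum_(u : U) (margYU P q y u * phi y u).
Proof.
rewrite exchange_big /=; apply: eq_bigr => y _.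
rewrite (eq_bigr (fun x => \rsum_(u : U) (P x y * q x u * phi y u))).
  by rewrite exchange_big /=; apply: eq_bigr => u _; rewrite rsumZr.
move=> x _; rewrite exchange_big /=; apply: eq_bigr => u _.
by rewrite rsumZr joint_sumZ.
Qed.

Lemma margYU_sum (y : Y) : \rsum_(u : U) margYU P q y u = margY P y.
Proof.
rewrite exchange_big /=; apply: eq_bigr => x _.
by rewrite rsumZl (proj2 (hq x)) Rmult_1_r.
Qed.

Lemma joint_sumY (phi : Y -> R) :
  \rsum_(x : X) \rsum_(y : Y) \rsum_(z : Z) \rsum_(u : U) (joint P q W x y z u * phi y)
  = \rsum_(y : Y) (margY P y * phi y).
Proof.
rewrite (joint_sumYU (fun y _ => phi y)); apply: eq_bigr => y _.
by rewrite rsumZr margYU_sum.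
Qed.

Lemma joint_sum1 : \rsum_(x : X) \rsum_(y : Y) \rsum_(z : Z) \rsum_(u : U) joint P q W x y z u = 1.
Proof.
rewrite -(proj2 hP); apply: eq_bigr => x _; apply: eq_bigr => y _.
exact: (jointXYZ_sumZ P hq hW).
Qed.

(** Each term is a sum of values of [eta], continuous also where atoms vanish, unlike the quotient
    under [ln]. The converse and the limit argument both work with this form. *)
Lemma mutinf_entropy : mutinf P q W
  = \rsum_(x : X) \rsum_(y : Y) \rsum_(z : Z) eta (jointXYZ P q W x y z)
    + \rsum_(y : Y) \rsum_(u : U) eta (margYU P q y u)
    - \rsum_(x : X) \rsum_(y : Y) \rsum_(z : Z) \rsum_(u : U) eta (joint P q W x y z u)
    - \rsum_(y : Y) eta (margY P y).
Proof.
rewrite /mutinf.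
transitivity (\rsum_(x : X) \rsum_(y : Y) \rsum_(z : Z) \rsum_(u : U)
  (joint P q W x y z u * - ln (jointXYZ P q W x y z)
   + joint P q W x y z u * - ln (margYU P q y u)
   - eta (joint P q W x y z u) - joint P q W x y z u * - ln (margY P y))).
  apply: eq_bigr => x _; apply: eq_bigr => y _; apply: eq_bigr => z _; apply: eq_bigr => u _.
  case: (joint_ge0 hP hq hW x y z u) => [h|<-]; last by rewrite eta0; ring.
  have [h1 h2 h3] := joint_pos hP hq hW h; move: (joint P q W x y z u) h => j h.
  rewrite /Rdiv ln_mult; [|exact: Rmult_lt_0_compat|by apply/Rinv_0_lt_compat/Rmult_lt_0_compat].
  rewrite ln_Rinv; last exact: Rmult_lt_0_compat.
  by rewrite !ln_mult // /eta; ring.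
have e1 : \rsum_(x : X) \rsum_(y : Y) \rsum_(z : Z) eta (jointXYZ P q W x y z)
  = \rsum_(x : X) \rsum_(y : Y) \rsum_(z : Z) \rsum_(u : U)
     (joint P q W x y z u * - ln (jointXYZ P q W x y z)).
  apply: eq_bigr => x _; apply: eq_bigr => y _; apply: eq_bigr => z _.
  by rewrite rsumZr -/(jointXYZ P q W x y z) /eta; ring.
have e2 : \rsum_(y : Y) \rsum_(u : U) eta (margYU P q y u)
  = \rsum_(x : X) \rsum_(y : Y) \rsum_(z : Z) \rsum_(u : U)
     (joint P q W x y z u * - ln (margYU P q y u)).
  rewrite (joint_sumYU (fun y u => - ln (margYU P q y u))).
  by apply: eq_bigr => y _; apply: eq_bigr => u _; rewrite /eta; ring.
have e3 : \rsum_(y : Y) eta (margY P y)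
  = \rsum_(x : X) \rsum_(y : Y) \rsum_(z : Z) \rsum_(u : U)
     (joint P q W x y z u * - ln (margY P y)).
  rewrite (joint_sumY (fun y => - ln (margY P y))).
  by apply: eq_bigr => y _; rewrite /eta; ring.
rewrite e1 e2 e3 -!rsumD -!rsumB; apply: eq_bigr => x _.
rewrite -!rsumD -!rsumB; apply: eq_bigr => y _.
rewrite -!rsumD -!rsumB; apply: eq_bigr => z _.
by rewrite -!rsumD -!rsumB; apply: eq_bigr => u _.
Qed.

End JointSums.

Lemma rprod_le1 (I : finType) (F : I -> R) : (forall i, 0 <= F i <= 1) ->
  \big[Rmult/R1]_(i : I) F i <= 1.
Proof.
move=> h; suff [] : 0 <= \big[Rmult/R1]_(i : I) F i <= 1 by [].
elim/big_rec: _ => [|i x _ hx]; first lra.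
by have := h i; nra.
Qed.

Lemma rsum2_ffun_prod (I A B : finType) (g : I -> A -> B -> R) :
  \rsum_(a : {ffun I -> A}) \rsum_(b : {ffun I -> B}) \big[Rmult/R1]_(i : I) g i (a i) (b i)
  = \big[Rmult/R1]_(i : I) \rsum_(a : A) \rsum_(b : B) g i a b.
Proof.
rewrite -(rsum_ffun_prod (fun i a => \rsum_(b : B) g i a b)); apply: eq_bigr => a _.
by rewrite -(rsum_ffun_prod (fun i b => g i (a i) b)).
Qed.

Lemma rsum2_fiber (A B A' B' : finType) (f : A -> A') (g : B -> B') (F : A -> B -> R)
    (phi : A' -> B' -> R) :
  \rsum_(a' : A') \rsum_(b' : B') ((\rsum_(a | f a == a') \rsum_(b | g b == b') F a b) * phi a' b')
  = \rsum_(a : A) \rsum_(b : B) (F a b * phi (f a) (g b)).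
Proof.
rewrite -[RHS](rsum_fiber f); apply: eq_bigr => a' _.
transitivity (\rsum_(b' : B') \rsum_(a | f a == a') \rsum_(b | g b == b') (F a b * phi a' b')).
  apply: eq_bigr => b' _; rewrite -rsumZr; apply: eq_bigr => a _; by rewrite rsumZr.
rewrite exchange_big /=; apply: eq_bigr => a /eqP <-.
rewrite -[RHS](rsum_fiber g); apply: eq_bigr => b' _.
by apply: eq_bigr => b /eqP <-.
Qed.

(** * Single-letter systems extracted from a block code *)

Section SingleLetter.
Variables (X Y Z : finType) (P : X -> Y -> R) (n m : nat).
Variables (enc : seqn n X -> 'I_m -> R) (dec : 'I_m -> seqn n Y -> seqn n Z -> R).
Hypotheses (hP : pmf2 P) (hE : channel enc) (hD : forall w, channel (dec w)).
Variable y0 : Y.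
Let Pn := @pXYn X Y P n.
Let Jn := joint Pn enc dec.
Let Un : finType := ('I_m * seqn n Y)%type.
Implicit Types (i : 'I_n) (v yn : seqn n Y) (xn : seqn n X) (zn : seqn n Z) (w : 'I_m).

Definition upd v i (y : Y) : seqn n Y := [ffun j => if j == i then y else v j].

(* The auxiliary variable for letter [i] is the message together with all of Bob's
   other letters; the unused coordinate [i] is pinned to the dummy value [y0]. *)
Definition slq i (x : X) (u : Un) : R :=
  if u.2 i == y0 then
    \rsum_(xn : seqn n X | xn i == x) ((\big[Rmult/R1]_(j | j != i) P (xn j) (u.2 j)) * enc xn u.1)
  else 0.

(** Bob's letter [y] returns to the pinned coordinate, which restores the whole block that the
    decoder expects. *)
Definition slW i (u : Un) (y : Y) (z : Z) : R :=
  \rsum_(zn : seqn n Z | zn i == z) dec u.1 (upd u.2 i y) zn.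

(** The joint weight of X_i = [x], Zhat_i = [z], M = [w] and the whole of Bob's block [yn]. *)
Definition slk i (x : X) (z : Z) w yn : R :=
  \rsum_(xn : seqn n X | xn i == x) \rsum_(zn : seqn n Z | zn i == z) Jn xn yn zn w.

Lemma slW_channel i u : channel (slW i u).
Proof.
move=> y; split=> [z|].
  by apply: rsum_ge0 => zn _; case: (hD u.1 (upd u.2 i y)).
rewrite /slW (rsum_fiber (fun zn : seqn n Z => zn i)).
by case: (hD u.1 (upd u.2 i y)).
Qed.

Lemma slq_channel i : channel (slq i).
Proof.
move=> x; split=> [u|].
  rewrite /slq; case: ifP => _; last lra.
  apply: rsum_ge0 => xn _; apply: Rmult_le_pos; last by case: (hE xn).
  by apply: rprod_ge0 => j _; case: hP.
(* Coordinate [i] carries the point mass at [(x, y0)], which encodes both pinning conditions; the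
   double sum is then a product of sums equal to 1. *)
pose g (j : 'I_n) (a : X) (b : Y) : R :=
  if j == i then (if (a == x) && (b == y0) then 1 else 0) else P a b.
transitivity (\rsum_(xn : seqn n X) \rsum_(v : seqn n Y) \rprod_(j < n) g j (xn j) (v j)); last first.
  rewrite (rsum2_ffun_prod g) big1 // => j _; rewrite /g; case: eqP => _; last by case: hP.
  transitivity (\rsum_(a : X) (if a == x then 1 else 0)); last exact: (rsum_delta x (fun=> 1)).
  apply: eq_bigr => a _; case: eqP => /= _; last by rewrite rsum0.
  exact: (rsum_delta y0 (fun=> 1)).
rewrite rsum_pair exchange_big /= [RHS]exchange_big /=; apply: eq_bigr => v _.
rewrite (eq_bigr (fun w => \rsum_(xn : seqn n X | xn i == x) ((\rprod_(j < n) g j (xn j) (v j)) * enc xn w))).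
  rewrite exchange_big /= -(rsum_if (fun xn : seqn n X => xn i == x)); apply: eq_bigr => xn _.
  case: ifP => h; first by rewrite rsumZl (proj2 (hE xn)) Rmult_1_r.
  by rewrite (bigD1 i) //= /g eqxx h /= Rmult_0_l.
move=> w _; rewrite /slq /=; case: ifP => h.
  apply: eq_bigr => xn hx; rewrite [in RHS](bigD1 i) //= {1}/g eqxx hx h /= Rmult_1_l.
  by congr (_ * _); apply: eq_bigr => j /negbTE ne; rewrite /g ne.
by rewrite rsum0 // => xn _; rewrite (bigD1 i) //= {1}/g eqxx h andbF !Rmult_0_l.
Qed.

Lemma pXYn_upd xn v i (y : Y) :
  Pn xn (upd v i y) = P (xn i) y * \big[Rmult/R1]_(j | j != i) P (xn j) (v j).
Proof.
rewrite /Pn /pXYn (bigD1 i) //= ffunE eqxx; congr (_ * _).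
by apply: eq_bigr => j /negbTE ne; rewrite ffunE ne.
Qed.

Lemma sl_joint i x y z (u : Un) :
  joint P (slq i) (slW i) x y z u = if u.2 i == y0 then slk i x z u.1 (upd u.2 i y) else 0.
Proof.
rewrite /joint /slq; case: ifP => _; last by rewrite Rmult_0_r Rmult_0_l.
rewrite -[P x y * _]rsumZl -rsumZr; apply: eq_bigr => xn /eqP hx.
rewrite /slW -rsumZl; apply: eq_bigr => zn _.
by rewrite /Jn /joint pXYn_upd hx -!Rmult_assoc.
Qed.

Lemma sl_margYU i y (u : Un) :
  margYU P (slq i) y u = if u.2 i == y0 then margYU Pn enc (upd u.2 i y) u.1 else 0.
Proof.
rewrite /margYU /slq; case: ifP => _; last by rewrite rsum0 // => *; rewrite Rmult_0_r.
rewrite -[RHS](rsum_fiber (fun xn : seqn n X => xn i)); apply: eq_bigr => x _.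
rewrite -rsumZl; apply: eq_bigr => xn /eqP hx.
by rewrite pXYn_upd hx -!Rmult_assoc.
Qed.

Lemma sum_upd i (y : Y) (G : seqn n Y -> R) :
  \rsum_(v : seqn n Y | v i == y0) G (upd v i y) = \rsum_(v : seqn n Y | v i == y) G v.
Proof.
rewrite [RHS](reindex_onto (fun v => upd v i y) (fun v => upd v i y0)) /=; last first.
  by move=> v /eqP h; apply/ffunP => j; rewrite !ffunE; case: eqP => // ->.
apply: eq_bigl => v; rewrite ffunE eqxx eqxx /=.
apply/eqP/eqP => [h|<-]; last by rewrite !ffunE eqxx.
by apply/ffunP => j; rewrite !ffunE; case: eqP => // ->.
Qed.

Lemma sum_upd2 i (G : 'I_m -> seqn n Y -> R) :
  \rsum_(y : Y) \rsum_(u : Un) (if u.2 i == y0 then G u.1 (upd u.2 i y) else 0)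
  = \rsum_(w : 'I_m) \rsum_(v : seqn n Y) G w v.
Proof.
rewrite (eq_bigr (fun y => \rsum_(w : 'I_m) \rsum_(v : seqn n Y | v i == y) G w v)).
  by rewrite exchange_big /=; apply: eq_bigr => w _; rewrite (rsum_fiber (fun v : seqn n Y => v i)).
move=> y _; rewrite rsum_pair /=; apply: eq_bigr => w _.
by rewrite (rsum_if (fun v : seqn n Y => v i == y0)) (sum_upd i y (G w)).
Qed.

Lemma sl_jointXYZ i x y z : jointXYZ P (slq i) (slW i) x y z =
  \rsum_(xn : seqn n X | xn i == x) \rsum_(yn : seqn n Y | yn i == y)
    \rsum_(zn : seqn n Z | zn i == z) jointXYZ Pn enc dec xn yn zn.
Proof.
rewrite /jointXYZ (eq_bigr _ (fun u _ => sl_joint i x y z u)) rsum_pair /=.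
rewrite (eq_bigr (fun w => \rsum_(yn : seqn n Y | yn i == y) slk i x z w yn)); last first.
  by move=> w _; rewrite (rsum_if (fun v : seqn n Y => v i == y0)) (sum_upd i y).
rewrite exchange_big /= [RHS]exchange_big /=; apply: eq_bigr => yn _.
rewrite exchange_big /=; apply: eq_bigr => xn _.
by rewrite exchange_big.
Qed.

Lemma slk_sum i w yn : \rsum_(x : X) \rsum_(z : Z) slk i x z w yn = margYU Pn enc yn w.
Proof.
transitivity (\rsum_(x : X) \rsum_(z : Z) (slk i x z w yn * 1)).
  by apply: eq_bigr => x _; apply: eq_bigr => z _; rewrite Rmult_1_r.
rewrite (rsum2_fiber (fun xn : seqn n X => xn i) (fun zn : seqn n Z => zn i)
   (fun xn zn => Jn xn yn zn w) (fun _ _ => 1)).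
apply: eq_bigr => xn _; rewrite -(joint_sumZ Pn enc hD); apply: eq_bigr => zn _.
by rewrite Rmult_1_r.
Qed.

Lemma slk_ge0 i x z w yn : 0 <= slk i x z w yn.
Proof.
apply: rsum_ge0 => xn _; apply: rsum_ge0 => zn _; apply: joint_ge0 => //.
exact: pXYn_pmf2.
Qed.

(** (Y_i,U_i) is a relabelling of (M,Y^n), so this entropy is the same for every letter. *)
Lemma sl_entropy_YU i : \rsum_(y : Y) \rsum_(u : Un) eta (margYU P (slq i) y u)
  = \rsum_(w : 'I_m) \rsum_(yn : seqn n Y) eta (margYU Pn enc yn w).
Proof.
rewrite -(sum_upd2 i (fun w yn => eta (margYU Pn enc yn w))).
apply: eq_bigr => y _; apply: eq_bigr => u _; rewrite sl_margYU.
by case: ifP => // _; exact: eta0.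
Qed.

Lemma sl_entropy_joint i :
  \rsum_(x : X) \rsum_(y : Y) \rsum_(z : Z) \rsum_(u : Un) eta (joint P (slq i) (slW i) x y z u)
  = \rsum_(w : 'I_m) \rsum_(yn : seqn n Y) \rsum_(x : X) \rsum_(z : Z) eta (slk i x z w yn).
Proof.
transitivity (\rsum_(x : X) \rsum_(z : Z) \rsum_(w : 'I_m) \rsum_(yn : seqn n Y) eta (slk i x z w yn)).
  apply: eq_bigr => x _; rewrite exchange_big /=; apply: eq_bigr => z _.
  rewrite -(sum_upd2 i (fun w yn => eta (slk i x z w yn))).
  apply: eq_bigr => y _; apply: eq_bigr => u _; rewrite sl_joint.
  by case: ifP => // _; exact: eta0.
rewrite pair_bigA exchange_big /=; apply: eq_bigr => w _.
by rewrite exchange_big /=; apply: eq_bigr => yn _; rewrite pair_bigA.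
Qed.

Lemma joint_fiber i w yn (phi : X -> Z -> R) :
  \rsum_(xn : seqn n X) \rsum_(zn : seqn n Z) (Jn xn yn zn w * phi (xn i) (zn i))
  = \rsum_(x : X) \rsum_(z : Z) (slk i x z w yn * phi x z).
Proof.
by rewrite -(rsum2_fiber (fun xn : seqn n X => xn i) (fun zn : seqn n Z => zn i)
   (fun xn zn => Jn xn yn zn w)).
Qed.

Lemma rsum4_swap (F : seqn n X -> seqn n Y -> seqn n Z -> 'I_m -> R) :
  \rsum_(xn : seqn n X) \rsum_(yn : seqn n Y) \rsum_(zn : seqn n Z) \rsum_(w : 'I_m) F xn yn zn w
  = \rsum_(w : 'I_m) \rsum_(yn : seqn n Y) \rsum_(xn : seqn n X) \rsum_(zn : seqn n Z) F xn yn zn w.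
Proof.
rewrite exchange_big /= [RHS]exchange_big /=; apply: eq_bigr => yn _.
rewrite [RHS]exchange_big /=; apply: eq_bigr => xn _.
by rewrite exchange_big.
Qed.

Let c w yn := margYU Pn enc yn w.
(** The comparison law for Gibbs' inequality: a uniform message, Bob's block with its own law, and,
    given both, pairs (x_i,z_i) drawn independently from their true conditional marginals. *)
Let Q xn yn zn w : R := / INR m * margY Pn yn *
  \rprod_(i < n) (slk i (xn i) (zn i) w yn / c w yn).

Lemma message_count_gt0 : 0 < INR m.
Proof.
have [x] := pmf2_inhab hP; have w := pmf_inhab (hE [ffun => x]).
by apply: lt_0_INR; apply/ltP; apply: leq_ltn_trans (ltn_ord w).
Qed.

(** Only an inequality: where [c w yn] vanishes, a conditional factor sums to 0 instead of 1. *)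
Lemma gibbs_law_sum : \rsum_(xn : seqn n X) \rsum_(yn : seqn n Y) \rsum_(zn : seqn n Z)
  \rsum_(w : 'I_m) Q xn yn zn w <= 1.
Proof.
have m0 := message_count_gt0; have im0 := Rinv_0_lt_compat _ m0.
have hPn := pXYn_pmf2 hP n.
rewrite rsum4_swap.
apply: (Rle_trans _ (\rsum_(w : 'I_m) \rsum_(yn : seqn n Y) (/ INR m * margY Pn yn))).
  apply: rsum_le => w _; apply: rsum_le => yn _.
  rewrite (eq_bigr (fun xn => / INR m * margY Pn yn * \rsum_(zn : seqn n Z)
    \rprod_(i < n) (slk i (xn i) (zn i) w yn / c w yn))); last first.
    by move=> xn _; rewrite rsumZl.
  rewrite rsumZl -[X in _ <= X]Rmult_1_r; apply: Rmult_le_compat_l.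
    apply: Rmult_le_pos; first lra.
    by apply: rsum_ge0 => xn _; case: hPn.
  rewrite (rsum2_ffun_prod (fun i x z => slk i x z w yn / c w yn)).
  apply: rprod_le1 => i.
  have e : \rsum_(x : X) \rsum_(z : Z) (slk i x z w yn / c w yn) = c w yn * / c w yn.
    rewrite -[X in _ = X * _](slk_sum i w yn) -rsumZr; apply: eq_bigr => x _; by rewrite rsumZr.
  rewrite e; case: (margYU_ge0 hPn hE yn w : 0 <= c w yn) => [h|<-]; last by rewrite Rmult_0_l; lra.
  by rewrite Rinv_r; lra.
rewrite (eq_bigr (fun _ => / INR m)) => [|w _].
  by rewrite rsum_const card_ord Rinv_r; lra.
rewrite rsumZl exchange_big /= (_ : \rsum_(xn : seqn n X) _ = 1) ?Rmult_1_r //.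
by case: hPn.
Qed.

(** Gibbs' inequality against [Q] does the work of two textbook steps: H(M|Y^n) is at most
    [ln (INR m)], and the entropy of (X^n,Zhat^n) given (M,Y^n) is at most the sum over its letters.
    In each summand on the left H(X_i,Y_i,Zhat_i) cancels, which leaves [Hc - Hk i - HY]. *)
Lemma sl_bound :
  \rsum_(i : 'I_n) (mutinf P (slq i) (slW i)
     - \rsum_(x : X) \rsum_(y : Y) \rsum_(z : Z) eta (jointXYZ P (slq i) (slW i) x y z))
  <= ln (INR m) - \rsum_(xn : seqn n X) \rsum_(yn : seqn n Y) \rsum_(zn : seqn n Z)
                     eta (jointXYZ Pn enc dec xn yn zn).
Proof.
have m0 := message_count_gt0; have im0 := Rinv_0_lt_compat _ m0.
have hPn := pXYn_pmf2 hP n.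
set Hc := \rsum_(w : 'I_m) \rsum_(yn : seqn n Y) eta (c w yn).
pose Hk i := \rsum_(w : 'I_m) \rsum_(yn : seqn n Y) \rsum_(x : X) \rsum_(z : Z) eta (slk i x z w yn).
set HY := \rsum_(y : Y) eta (margY P y).
rewrite (eq_bigr (fun i => Hc - Hk i - HY)) => [|i _]; last first.
  rewrite mutinf_entropy //; [|exact: slq_channel|exact: slW_channel].
  by rewrite sl_entropy_YU sl_entropy_joint -/(Hk i) -/Hc -/HY; ring.
set H := \rsum_(xn : seqn n X) _.
have eYn : \rsum_(yn : seqn n Y) eta (margY Pn yn) = INR n * HY.
  have pY : pmf (margY P).
    split=> [y|]; first by apply: rsum_ge0 => x _; case: hP.
    by rewrite exchange_big; case: hP.
  rewrite -[n in INR n]card_ord -(prodlaw_entropy _ pY); apply: eq_bigr => yn _.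
  by rewrite /Pn block_margY.
have hJ : H <= \rsum_(xn : seqn n X) \rsum_(yn : seqn n Y) \rsum_(zn : seqn n Z)
    \rsum_(w : 'I_m) eta (Jn xn yn zn w).
  apply: rsum_le => xn _; apply: rsum_le => yn _; apply: rsum_le => zn _.
  by apply: eta_rsum => w; apply: joint_ge0.
have Q0 xn yn zn w : 0 <= Q xn yn zn w.
  apply: Rmult_le_pos; first (apply: Rmult_le_pos; first lra).
    by apply: rsum_ge0 => x _; case: hPn.
  apply: rprod_ge0 => i _; case: (margYU_ge0 hPn hE yn w : 0 <= c w yn) => [h|h].
    by apply: Rmult_le_pos; [exact: slk_ge0 | apply/Rlt_le/Rinv_0_lt_compat].
  have := @rsum_ge_term _ xpredT (fun x => \rsum_(z : Z) slk i x z w yn) (xn i).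
  rewrite slk_sum -/(c w yn) -h => /(_ (fun x _ => rsum_ge0 (fun z _ => slk_ge0 _ _ _ _ _)) isT).
  have := @rsum_ge_term _ xpredT (fun z => slk i (xn i) z w yn) (zn i) (fun z _ => slk_ge0 _ _ _ _ _) isT.
  have := slk_ge0 i (xn i) (zn i) w yn => h1 h2 h3.
  have -> : slk i (xn i) (zn i) w yn = 0 by lra.
  by rewrite /Rdiv Rmult_0_l; lra.
have pos xn yn zn w : 0 < Jn xn yn zn w ->
    [/\ 0 < margY Pn yn, 0 < c w yn & forall i, 0 < slk i (xn i) (zn i) w yn].
  move=> h; have [h1 h2 _] := joint_pos hPn hE hD h; split=> // i.
  apply: Rlt_le_trans h _.
  have J0 xn' zn' : 0 <= Jn xn' yn zn' w by apply: joint_ge0.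
  apply: Rle_trans (@rsum_ge_term _ (fun xn' : seqn n X => xn' i == xn i)
     (fun xn' => \rsum_(zn' : seqn n Z | zn' i == zn i) Jn xn' yn zn' w) xn _ (eqxx _)).
    exact: (@rsum_ge_term _ (fun zn' : seqn n Z => zn' i == zn i) (fun zn' => Jn xn yn zn' w) zn).
  by move=> xn' _; apply: rsum_ge0.
have hg : \rsum_(xn : seqn n X) \rsum_(yn : seqn n Y) \rsum_(zn : seqn n Z)
    \rsum_(w : 'I_m) (Jn xn yn zn w * ln (Q xn yn zn w))
  <= - \rsum_(xn : seqn n X) \rsum_(yn : seqn n Y) \rsum_(zn : seqn n Z)
    \rsum_(w : 'I_m) eta (Jn xn yn zn w).
  pose flat (F : seqn n X -> seqn n Y -> seqn n Z -> 'I_m -> R) :=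
    fun a : seqn n X * seqn n Y * seqn n Z * 'I_m => F a.1.1.1 a.1.1.2 a.1.2 a.2.
  have e F : \rsum_(xn : seqn n X) \rsum_(yn : seqn n Y) \rsum_(zn : seqn n Z)
    \rsum_(w : 'I_m) F xn yn zn w = \rsum_(a : seqn n X * seqn n Y * seqn n Z * 'I_m) flat F a.
    by rewrite rsum_pair rsum_pair rsum_pair.
  rewrite !e -rsumN.
  rewrite [X in _ <= X](eq_bigr (fun a => flat Jn a * ln (flat Jn a))) => [|a _]; last first.
    by rewrite /flat /eta Ropp_involutive.
  apply: (@gibbs _ (flat Jn) (flat Q)) => [a|a|a|].
  - exact: joint_ge0.
  - exact: Q0.
  - case: a => [[[xn yn] zn] w]; rewrite /flat /= => /pos [h1 h2 h3].
    apply: Rmult_lt_0_compat; first exact: Rmult_lt_0_compat.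
    by apply: rprod_gt0 => i _; apply: Rdiv_lt_0_compat.
  - by rewrite -!e; apply: Rle_trans gibbs_law_sum _; rewrite /Jn joint_sum1 //; lra.
have eQ : \rsum_(xn : seqn n X) \rsum_(yn : seqn n Y) \rsum_(zn : seqn n Z)
    \rsum_(w : 'I_m) (Jn xn yn zn w * ln (Q xn yn zn w))
  = - ln (INR m) - INR n * HY + \rsum_(i : 'I_n) (Hc - Hk i).
  have t1 : - ln (INR m) = \rsum_(xn : seqn n X) \rsum_(yn : seqn n Y) \rsum_(zn : seqn n Z)
    \rsum_(w : 'I_m) (Jn xn yn zn w * - ln (INR m)).
    rewrite (joint_sumY Pn hE hD (fun _ => - ln (INR m))) rsumZr.
    by rewrite /margY exchange_big /= (proj2 hPn) Rmult_1_l.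
  have t2 : - (INR n * HY) = \rsum_(xn : seqn n X) \rsum_(yn : seqn n Y) \rsum_(zn : seqn n Z)
    \rsum_(w : 'I_m) (Jn xn yn zn w * ln (margY Pn yn)).
    rewrite (joint_sumY Pn hE hD (fun yn => ln (margY Pn yn))) -eYn -rsumN.
    by apply: eq_bigr => yn _; rewrite /eta Ropp_involutive.
  have t3 : - Hc = \rsum_(xn : seqn n X) \rsum_(yn : seqn n Y) \rsum_(zn : seqn n Z)
    \rsum_(w : 'I_m) (Jn xn yn zn w * ln (c w yn)).
    rewrite (joint_sumYU Pn enc hD (fun yn w => ln (c w yn))) exchange_big /= -rsumN.
    apply: eq_bigr => w _; rewrite -rsumN; apply: eq_bigr => yn _.
    by rewrite /eta Ropp_involutive.
  have t4 i : - Hk i = \rsum_(xn : seqn n X) \rsum_(yn : seqn n Y) \rsum_(zn : seqn n Z)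
    \rsum_(w : 'I_m) (Jn xn yn zn w * ln (slk i (xn i) (zn i) w yn)).
    rewrite rsum4_swap /Hk -rsumN; apply: eq_bigr => w _; rewrite -rsumN; apply: eq_bigr => yn _.
    rewrite (joint_fiber i w yn (fun x z => ln (slk i x z w yn))) -rsumN.
    apply: eq_bigr => x _; rewrite -rsumN; apply: eq_bigr => z _.
    by rewrite /eta Ropp_involutive.
  have t5 : \rsum_(i : 'I_n) (Hc - Hk i) = \rsum_(xn : seqn n X) \rsum_(yn : seqn n Y)
    \rsum_(zn : seqn n Z) \rsum_(w : 'I_m)
      \rsum_(i : 'I_n) (Jn xn yn zn w * (ln (slk i (xn i) (zn i) w yn) - ln (c w yn))).
    rewrite (eq_bigr (fun i => \rsum_(xn : seqn n X) \rsum_(yn : seqn n Y)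
      \rsum_(zn : seqn n Z) \rsum_(w : 'I_m)
      (Jn xn yn zn w * (ln (slk i (xn i) (zn i) w yn) - ln (c w yn))))) => [|i _]; last first.
      have -> : Hc - Hk i = - Hk i - - Hc by ring.
      rewrite t4 t3 -rsumB; apply: eq_bigr => xn _; rewrite -rsumB; apply: eq_bigr => yn _.
      rewrite -rsumB; apply: eq_bigr => zn _; rewrite -rsumB; apply: eq_bigr => w _; ring.
    rewrite exchange_big /=; apply: eq_bigr => xn _; rewrite exchange_big /=; apply: eq_bigr => yn _.
    by rewrite exchange_big /=; apply: eq_bigr => zn _; rewrite exchange_big.
  rewrite /Rminus t2 {1}t1 [\rsum_(i : 'I_n) _]t5.
  rewrite -!rsumD; apply: eq_bigr => xn _; rewrite -!rsumD; apply: eq_bigr => yn _.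
  rewrite -!rsumD; apply: eq_bigr => zn _; rewrite -!rsumD; apply: eq_bigr => w _.
  case: (joint_ge0 hPn hE hD xn yn zn w); rewrite -/Jn => h; last first.
    by rewrite -h !Rmult_0_l [X in _ = _ + X]rsum0 => [|i _]; ring.
  have [h1 h2 h3] := pos _ _ _ _ h.
  rewrite rsumZl -!Rmult_plus_distr_l; congr (_ * _).
  have r0 : 0 < \rprod_(i < n) (slk i (xn i) (zn i) w yn / c w yn).
    by apply: rprod_gt0 => i _; apply: Rdiv_lt_0_compat.
  rewrite /Q ln_mult //; last exact: Rmult_lt_0_compat.
  rewrite ln_mult // ln_Rinv // ln_rprod => [|i]; last exact: Rdiv_lt_0_compat.
  congr (_ + _); apply: eq_bigr => i _.
  by rewrite /Rdiv ln_mult // ?ln_Rinv //; apply: Rinv_0_lt_compat.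
rewrite eQ in hg.
have fin (l a s b : R) : - l - a + s <= - b -> H <= b -> s - a <= l - H by lra.
by rewrite rsumB [X in _ - X]rsum_const card_ord; exact: fin hg hJ.
Qed.

End SingleLetter.

(** * Converse *)

Lemma INR_expn (a n : nat) : INR (a ^ n) = (INR a ^ n)%R.
Proof. by elim: n => [//|n ih]; rewrite expnS mult_INR ih. Qed.

Section Converse.
Variables (X Y Z : finType) (P : X -> Y -> R) (pZ : X -> Y -> Z -> R).
Hypotheses (hP : pmf2 P) (hZ : forall x y, pmf (pZ x y)).

Let T3 (a : X * Y * Z) : R := P a.1.1 a.1.2 * pZ a.1.1 a.1.2 a.2.

Lemma T3_pmf : pmf T3.
Proof.
split=> [a|]; first by apply: Rmult_le_pos; [case: hP | case: (hZ a.1.1 a.1.2)].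
rewrite rsum_pair rsum_pair -(proj2 hP); apply: eq_bigr => x _; apply: eq_bigr => y _.
by rewrite /T3 /= rsumZl (proj2 (hZ x y)) Rmult_1_r.
Qed.

Lemma target_marginal n (i : 'I_n) x y z :
  \rsum_(xn : seqn n X | xn i == x) \rsum_(yn : seqn n Y | yn i == y)
    \rsum_(zn : seqn n Z | zn i == z) target P pZ xn yn zn = P x y * pZ x y z.
Proof.
transitivity (\rsum_(xn : seqn n X) \rsum_(yn : seqn n Y) \rsum_(zn : seqn n Z)
  (target P pZ xn yn zn * (if (xn i, yn i, zn i) == (x, y, z) then 1 else 0))).
  rewrite -(rsum_if (fun xn : seqn n X => xn i == x)); apply: eq_bigr => xn _.
  case: (boolP (xn i == x)) => hx; last first.
    rewrite rsum0 // => yn _; rewrite rsum0 // => zn _.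
    by rewrite !xpair_eqE (negbTE hx) Rmult_0_r.
  rewrite -(rsum_if (fun yn : seqn n Y => yn i == y)); apply: eq_bigr => yn _.
  case: (boolP (yn i == y)) => hy; last first.
    by rewrite rsum0 // => zn _; rewrite !xpair_eqE (negbTE hy) andbF Rmult_0_r.
  rewrite -(rsum_if (fun zn : seqn n Z => zn i == z)); apply: eq_bigr => zn _.
  rewrite !xpair_eqE hx hy /=; case: ifP => _; ring.
rewrite (rsum_ffun_zip3 (fun xn yn zn => target P pZ xn yn zn *
   (if (xn i, yn i, zn i) == (x, y, z) then 1 else 0))).
rewrite (eq_bigr (fun f => prodlaw T3 f * (if f i == (x, y, z) then 1 else 0))) => [|f _].
  rewrite (prodlaw_expect T3_pmf i (fun a => if a == (x, y, z) then 1 else 0)).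
  rewrite (eq_bigr (fun a => if a == (x, y, z) then T3 a else 0)) ?rsum_delta //.
  by move=> a _; case: ifP => _; ring.
rewrite !ffunE; congr (_ * _).
by apply: eq_bigr => j _; rewrite !ffunE.
Qed.

Lemma converse (Rate : R) : achievable P pZ Rate -> forall eps, 0 < eps ->
  exists (U : finType) (q : X -> U -> R) (W : U -> Y -> Z -> R),
    [/\ channel q, forall u, channel (W u),
     forall x y z, Rabs (jointXYZ P q W x y z - P x y * pZ x y z) <= eps &
     mutinf P q W - \rsum_(x : X) \rsum_(y : Y) \rsum_(z : Z) eta (jointXYZ P q W x y z)
     <= Rate * ln 2 - \rsum_(x : X) \rsum_(y : Y) \rsum_(z : Z) eta (P x y * pZ x y z) + eps].
Proof.
move=> [m [c [hc htv]]] eps eps0.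
have [[x0 y0] z0] := pmf_inhab T3_pmf.
set lA := ln (INR #|{: X * Y * Z}|).
have lA0 : 0 <= lA.
  rewrite /lA -ln_1; apply: ln_le; first lra.
  by apply: (le_INR 1); apply/leP/card_gt0P; exists (x0, y0, z0).
(* [eps / 2] keeps the letter marginals within [eps], [/ 2] keeps [2 * e] below 1, and the third
   bound absorbs the part of the entropy error proportional to n. The constant 2 that remains is
   absorbed by [4 / eps < INR n]. *)
pose e := Rmin (eps / 2) (Rmin (/ 2) (eps / (4 * (lA + 1)))).
have e4 : 0 < eps / (4 * (lA + 1)) by apply: Rdiv_lt_0_compat; lra.
have e0 : 0 < e by do 2 (apply: Rmin_glb_lt; try lra).
have e1 : e <= eps / 2 by apply: Rmin_l.
have e2 : e <= / 2 by apply: Rle_trans (Rmin_r _ _) (Rmin_l _ _).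
have e3 : e * lA <= eps / 4.
  have h : e <= eps / (4 * (lA + 1)) by apply: Rle_trans (Rmin_r _ _) (Rmin_r _ _).
  have -> : eps / 4 = eps / (4 * (lA + 1)) * (lA + 1) by field; lra.
  by apply: Rmult_le_compat; lra.
have [N hN] := htv e e0.
have [n1 [_ hn1]] := @nat_floor (4 / eps) (ltac:(apply/Rlt_le/Rdiv_lt_0_compat; lra)).
have [n nN nI] : exists2 n, (N <= n)%N & 4 / eps < INR n.
  exists (N + n1).+1; first by rewrite -addnS leq_addr.
  by rewrite S_INR plus_INR; have := pos_INR N; lra.
have n0 : 0 < INR n by apply: Rlt_trans nI; apply: Rdiv_lt_0_compat; lra.
have hn := hN n nN; case: (hc n) => hv hm {hN htv hc}.
case: (c n) hv hn => enc dec [/= hE hD] hn.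
set mm := m n in enc dec hE hD hm hn.
have iE xn yn zn : induced P (Code enc dec) xn yn zn = jointXYZ (@pXYn X Y P n) enc dec xn yn zn.
  by rewrite /induced /jointXYZ -rsumZl; apply: eq_bigr => w _; rewrite /joint Rmult_assoc.
set dl := \rsum_(xn : seqn n X) \rsum_(yn : seqn n Y) \rsum_(zn : seqn n Z)
   Rabs (jointXYZ (@pXYn X Y P n) enc dec xn yn zn - target P pZ xn yn zn).
have hdl : dl <= 2 * e.
  have : dl = 2 * tv (induced P (Code enc dec)) (target P pZ (n:=n)).
    rewrite /tv -Rmult_assoc Rinv_r ?Rmult_1_l; last lra.
    by apply: eq_bigr => xn _; apply: eq_bigr => yn _; apply: eq_bigr => zn _; rewrite iE.
  lra.
have hb := sl_bound hP hE hD y0.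
set Hn := \rsum_(xn : seqn n X) _ in hb.
have hent : INR n * (\rsum_(a : X * Y * Z) eta (T3 a)) <= Hn + dl * (1 + INR n * lA) + 1.
  have hPn := pXYn_pmf2 hP n.
  have hpr : pmf (fun f : {ffun 'I_n -> X * Y * Z} => jointXYZ (@pXYn X Y P n) enc dec
      [ffun i => (f i).1.1] [ffun i => (f i).1.2] [ffun i => (f i).2]).
    split=> [f|]; first exact: jointXYZ_ge0.
    by rewrite -(rsum_ffun_zip3 (fun xn yn zn => jointXYZ (@pXYn X Y P n) enc dec xn yn zn)) joint_sum1.
  have := entropy_perturb [ffun => (x0, y0, z0)] hpr (prodlaw_pmf 'I_n T3_pmf).
  rewrite (prodlaw_entropy _ T3_pmf) card_ord card_ffun card_ord INR_expn ln_pow; last first.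
    by apply: lt_0_INR; apply/ltP/card_gt0P; exists (x0, y0, z0).
  rewrite -/lA -(rsum_ffun_zip3 (fun xn yn zn => eta (jointXYZ (@pXYn X Y P n) enc dec xn yn zn))).
  rewrite -/Hn => h; apply: Rle_trans h _; apply: Req_le; congr (_ + _ * _ + _).
  rewrite /dl (rsum_ffun_zip3 (fun xn yn zn =>
    Rabs (jointXYZ (@pXYn X Y P n) enc dec xn yn zn - target P pZ xn yn zn))).
  apply: eq_bigr => f _; congr (Rabs (_ - _)).
  by apply: eq_bigr => i _; rewrite !ffunE.
rewrite rsum_pair rsum_pair /T3 /= in hent.
set HT := \rsum_(x : X) _ in hent *.
have un : pmf (fun _ : 'I_n => / INR n).
  by have := @unif_pmf 'I_n; rewrite card_ord; apply; apply/ltP/INR_lt.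
pose F i := mutinf P (slq P enc y0 i) (slW dec i) - \rsum_(x : X) \rsum_(y : Y) \rsum_(z : Z)
  eta (jointXYZ P (slq P enc y0 i) (slW dec i) x y z).
have [i hi] : exists i, F i <= / INR n * \rsum_(i : 'I_n) F i.
  by apply: (pmf_exists_le un); apply: Req_le; rewrite rsumZl.
have lm : ln (INR mm) <= INR n * (Rate * ln 2).
  have -> : INR n * (Rate * ln 2) = ln (Rpower 2 (INR n * Rate)) by rewrite /Rpower ln_exp; ring.
  by apply: ln_le; [exact: message_count_gt0 hP hE | exact: hm].
exists ('I_mm * seqn n Y)%type, (slq P enc y0 i), (slW dec i); split.
- exact: slq_channel.
- by move=> u; apply: slW_channel.
- move=> x y z; rewrite (sl_jointXYZ P enc dec) -(target_marginal i).
  apply: (Rle_trans _ dl); last lra.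
  rewrite -rsumB; apply: Rle_trans (rsum_abs _ _) _.
  apply: Rle_trans (rsum_subpred (Q := xpredT) _ _) _ => // [xn|]; first exact: Rabs_pos.
  apply: rsum_le => xn _; rewrite -rsumB; apply: Rle_trans (rsum_abs _ _) _.
  apply: Rle_trans (rsum_subpred (Q := xpredT) _ _) _ => // [yn|]; first exact: Rabs_pos.
  apply: rsum_le => yn _; rewrite -rsumB; apply: Rle_trans (rsum_abs _ _) _.
  by apply: rsum_subpred => // zn; apply: Rabs_pos.
- apply: Rle_trans hi _.
  apply: (Rmult_le_reg_l (INR n)) => //.
  rewrite -[X in X <= _]Rmult_assoc Rinv_r ?Rmult_1_l; last lra.
  apply: Rle_trans hb _.
  have h4 : 4 < eps * INR n.
    have := Rmult_lt_compat_l _ _ _ eps0 nI.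
    by have -> : eps * (4 / eps) = 4 by field; lra.
  have h5 : dl * (1 + INR n * lA) <= 2 * e * (1 + INR n * lA).
    by apply: Rmult_le_compat_r => //; have := Rmult_le_pos _ _ (Rlt_le _ _ n0) lA0; lra.
  have h6 := Rmult_le_compat_l _ _ _ (Rlt_le _ _ n0) e3.
  nra.
Qed.

End Converse.

(** * Alphabet reduction *)

(** Gaussian elimination along the list of constraints. One that vanishes on [S] is dropped;
    otherwise a pivot [u0] is removed from [S], its vector is eliminated from the others, and its
    coefficient is restored at the end. *)
Lemma linear_dependence (U : finType) (D : eqType) (s : seq D) (S : {set U}) (v : U -> D -> R) :
  (size s < #|S|)%N ->
  exists mu : U -> R, [/\ exists2 u, u \in S & mu u <> 0, forall u, u \notin S -> mu u = 0 &
    forall d, d \in s -> \rsum_(u : U) (mu u * v u d) = 0].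
Proof.
elim: s S v => [|d s ih] S v hs.
  have [u0 u0S] : exists u0, u0 \in S by apply/card_gt0P.
  exists (fun u => if u == u0 then 1 else 0); split=> //.
  - by exists u0 => //; rewrite eqxx; lra.
  - by move=> u; case: eqP => // ->; rewrite u0S.
case: (classic (forall u, u \in S -> v u d = 0)) => [h|/not_all_ex_not [u0 h]].
  have [mu [h1 h2 h3]] := ih S v (ltnW hs).
  exists mu; split=> // e; rewrite inE => /orP[/eqP ->|]; last exact: h3.
  rewrite rsum0 // => u _; case: (boolP (u \in S)) => hu; first by rewrite h //; ring.
  by rewrite h2 // Rmult_0_l.
have [u0S vd] : u0 \in S /\ v u0 d <> 0 by exact: imply_to_and h.
pose v' u e := v u e - v u d / v u0 d * v u0 e.
have [|mu [[u1 u1S mu1] h2 h3]] := ih (S :\ u0) v'.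
  by move: hs; rewrite (cardsD1 u0 S) u0S.
pose c := - \rsum_(u : U) (mu u * (v u d / v u0 d)).
exists (fun u => mu u + (if u == u0 then c else 0)).
have e f : \rsum_(u : U) ((mu u + (if u == u0 then c else 0)) * v u f)
    = \rsum_(u : U) (mu u * v' u f).
  transitivity (\rsum_(u : U) (mu u * v u f) + c * v u0 f).
    rewrite -(rsum_delta u0 (fun u => c * v u f)) -rsumD; apply: eq_bigr => u _.
    by case: ifP => _; ring.
  rewrite /c Ropp_mult_distr_l_reverse -rsumZr -rsumN -rsumD; apply: eq_bigr => u _.
  by rewrite /v'; ring.
split.
- exists u1; first by move: u1S; rewrite !inE => /andP[].
  by move: u1S; rewrite !inE => /andP[/negbTE -> _]; lra.
- move=> u hu; rewrite h2; last by rewrite !inE (negbTE hu) andbF.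
  by case: eqP => [eu|_]; [move: hu; rewrite eu u0S | lra].
- move=> f hf; rewrite e; move: hf; rewrite inE => /orP[/eqP ->|]; last exact: h3.
  by rewrite rsum0 // => u _; rewrite /v'; field.
Qed.

Lemma exists_argmin (U : finType) (Q : pred U) (F : U -> R) (u0 : U) : Q u0 ->
  exists2 u, Q u & forall u', Q u' -> F u <= F u'.
Proof.
move=> h0.
suff h (s : seq U) : exists2 u, Q u & forall u', u' \in s -> Q u' -> F u <= F u'.
  by have [u hu hm] := h (enum U); exists u => // u'; apply: hm; rewrite mem_enum.
elim: s => [|a s [u hu hm]]; first by exists u0.
case: (boolP (Q a && ~~ Rleb (F u) (F a))) => [/andP[qa /RlebP/Rnot_le_lt lt]|].
  exists a => // u'; rewrite inE => /orP[/eqP ->|hu' qu']; first lra.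
  by have := hm u' hu' qu'; lra.
rewrite negb_and negbK => h; exists u => // u'; rewrite inE => /orP[/eqP ->|]; last exact: hm.
by move=> qa; move: h; rewrite qa => /RlebP.
Qed.

Definition posupp (U : finType) (al : U -> R) : {set U} := [set u | ~~ Rleb (al u) 0].

Lemma posuppP (U : finType) (al : U -> R) u : reflect (0 < al u) (u \in posupp al).
Proof. by rewrite inE; apply: (iffP idP) => [/RlebP h|h]; [lra | apply/RlebP; lra]. Qed.

(* Conic Caratheodory: moving along a linear dependency until a weight vanishes. The
   constant constraint [d1] forces every dependency to have a negative entry. *)
Lemma support_reduction (U : finType) (D : eqType) (s : seq D) (v : U -> D -> R) (d1 : D)
    (al : U -> R) : d1 \in s -> (forall u, v u d1 = 1) -> (forall u, 0 <= al u) ->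
  exists al' : U -> R, [/\ forall u, 0 <= al' u, (#|posupp al'| <= size s)%N &
    forall d, d \in s -> \rsum_(u : U) (al' u * v u d) = \rsum_(u : U) (al u * v u d)].
Proof.
move=> d1s v1; move: {2}#|posupp al| (leqnn #|posupp al|) => N.
elim: N al => [|N ih] al hN al0; first by exists al; split=> //; apply: leq_trans hN _.
case: (leqP #|posupp al| (size s)) => [hs|/(linear_dependence v)]; first by exists al.
move=> [mu [[u2 u2S mu2] muS mus]].
have alS u : u \notin posupp al -> al u = 0.
  by move/posuppP => h; have := al0 u; lra.
have [u0 neg0] : exists u, mu u < 0.
  apply: NNPP => hn; apply: mu2.
  have mu0 u : 0 <= mu u by apply: Rnot_lt_le => h; apply: hn; exists u.
  apply: (rsum_eq0 (P := xpredT) (fun u _ => mu0 u)) => //.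
  by rewrite -(mus _ d1s); apply: eq_bigr => u _; rewrite v1 Rmult_1_r.
(* [u1] is the first weight to reach zero along [mu], so the step [t] below keeps all the others
   nonnegative. *)
have [u1 /RlebP/Rnot_le_lt neg1 min1] :=
  @exists_argmin U (fun u => ~~ Rleb 0 (mu u)) (fun u => al u / - mu u) u0
    (introN (RlebP _ _) (Rlt_not_le _ _ neg0)).
pose t := al u1 / - mu u1.
have t0 : 0 <= t by apply: Rmult_le_pos => //; apply/Rlt_le/Rinv_0_lt_compat; lra.
pose al' u := al u + t * mu u.
have al'0 u : 0 <= al' u.
  case: (Rle_lt_dec 0 (mu u)) => h; first by have := al0 u; have := Rmult_le_pos _ _ t0 h; rewrite /al'; lra.
  have := min1 u (introN (RlebP _ _) (Rlt_not_le _ _ h)); rewrite -/t => ht.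
  have := Rmult_le_compat_r (- mu u) _ _ ltac:(lra) ht.
  have -> : al u / - mu u * - mu u = al u by field; lra.
  rewrite /al'; lra.
have u1S : u1 \in posupp al.
  by apply/negPn/negP => /muS h; lra.
have z1 : al' u1 = 0 by rewrite /al' /t; field; lra.
have sub : posupp al' \subset posupp al :\ u1.
  apply/subsetP => u /posuppP h; rewrite !inE; apply/andP; split.
    by apply/eqP => e; rewrite e z1 in h; lra.
  have : u \in posupp al; last by rewrite inE.
  apply/negPn/negP => hu; move: h; rewrite /al' (alS u hu) (muS u hu); lra.
have [||al'' [h1 h2 h3]] := ih al'; last 1 first.
- exists al''; split=> // d hd; rewrite h3 // /al'.
  rewrite (eq_bigr (fun u => al u * v u d + t * (mu u * v u d))) => [|u _]; last by ring.
  by rewrite rsumD rsumZl mus // Rmult_0_r Rplus_0_r.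
- by rewrite -ltnS; apply: leq_trans hN; rewrite (cardsD1 u1 (posupp al)) u1S ltnS; apply: subset_leq_card.
- exact: al'0.
Qed.

Lemma rsum_enum_nth (U : finType) (S : {set U}) (K : nat) (u0 : U) (F : U -> R) : (#|S| <= K)%N ->
  \rsum_(k : 'I_K) (if (k < #|S|)%N then F (nth u0 (enum S) k) else 0) = \rsum_(u | u \in S) F u.
Proof.
move=> hK; rewrite -(big_mkcond (fun k : 'I_K => (k < #|S|)%N)) /=.
rewrite -(big_ord_widen_cond K xpredT (fun k => F (nth u0 (enum S) k)) hK).
by rewrite [RHS]big_enum_val; apply: eq_bigr => k _; rewrite (enum_val_nth u0).
Qed.

(** * Reweighting the letters of the auxiliary variable *)

Section Cardinality.
Variables (X Y Z U : finType) (P : X -> Y -> R) (q : X -> U -> R) (W : U -> Y -> Z -> R).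
Hypotheses (hP : pmf2 P) (hq : channel q) (hW : forall u, channel (W u)).
Let K := (#|X| * #|Y| * #|Z| + 2)%N.

(** The share of letter [u] in the information. Rescaling the letter multiplies its share by the
    same factor, which cancels in the quotient as long as the law of (X,Y,Z) is kept; hence the
    information is linear in the letter weights. *)
Let info u : R := \rsum_(x : X) \rsum_(y : Y) \rsum_(z : Z)
  (joint P q W x y z u * ln (joint P q W x y z u * margY P y / (margYU P q y u * jointXYZ P q W x y z))).

Lemma mutinf_info : mutinf P q W = \rsum_(u : U) info u.
Proof.
rewrite /info [RHS]exchange_big /=; apply: eq_bigr => x _.
rewrite [RHS]exchange_big /=; apply: eq_bigr => y _.
by rewrite [RHS]exchange_big.
Qed.

Lemma cardinality_bound : exists (q' : X -> 'I_K -> R) (W' : 'I_K -> Y -> Z -> R),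
  [/\ channel q', forall k, channel (W' k),
      forall x y z, jointXYZ P q' W' x y z = jointXYZ P q W x y z &
      mutinf P q' W' = mutinf P q W].
Proof.
have [x0] := pmf2_inhab hP.
have u0 := pmf_inhab (hq x0).
(* [None] is the total weight, [Some None] the information, and the other constraints fix the law of
   (X,Y,Z). The weights to be reduced start at 1 for every letter. *)
pose D : finType := option (option (X * Y * Z)).
pose v (u : U) (d : D) : R := match d with
  | None => 1 | Some None => info u
  | Some (Some a) => joint P q W a.1.1 a.1.2 a.2 u end.
have [|//||al [al0 hS hal]] := @support_reduction U D (enum D) v None (fun _ => 1).
- by rewrite mem_enum.
- by move=> _; lra.
have sK : (#|posupp al| <= K)%N.
  by apply: leq_trans hS _; rewrite -cardE !card_option !card_prod /K addn2.
pose phi (k : 'I_K) := nth u0 (enum (posupp al)) k.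
pose a (k : 'I_K) := if (k < #|posupp al|)%N then al (phi k) else 0.
have a0 k : 0 <= a k by rewrite /a; case: ifP => // _; lra.
have suma F : \rsum_(k : 'I_K) (a k * F (phi k)) = \rsum_(u : U) (al u * F u).
  transitivity (\rsum_(u | u \in posupp al) (al u * F u)).
    rewrite -(rsum_enum_nth u0 _ sK); apply: eq_bigr => k _; rewrite /a.
    by case: ifP => _ //; ring.
  rewrite -(rsum_if (fun u => u \in posupp al)); apply: eq_bigr => u _.
  case: ifP => // /negbT /posuppP h.
  have -> : al u = 0 by have := al0 u; lra.
  by ring.
have halJ x y z : \rsum_(u : U) (al u * joint P q W x y z u) = jointXYZ P q W x y z.
  have := hal (Some (Some (x, y, z))); rewrite mem_enum => /(_ isT) /= ->.
  by apply: eq_bigr => u _; ring.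
have hali : \rsum_(u : U) (al u * info u) = mutinf P q W.
  have := hal (Some None); rewrite mem_enum => /(_ isT) /= ->.
  by rewrite mutinf_info; apply: eq_bigr => u _; ring.
have P0 x y : 0 <= P x y by case: hP.
pose px x := \rsum_(y : Y) P x y.
have K0 : (0 < K)%N by rewrite /K addn2.
pose k0 : 'I_K := Ordinal K0.
(* Scaling [q] by the weights stays normalised because the law of X is preserved, an argument that
   fails where [px x] is zero. There a point mass is put in, invisible in the joint law. *)
pose q' x k := if Rlt_dec 0 (px x) then a k * q x (phi k) else if k == k0 then 1 else 0.
pose W' k := W (phi k).
have hq' : channel q'.
  move=> x; rewrite /q'; case: Rlt_dec => h /=; last first.
    split=> [k|]; first by case: ifP => _; lra.
    by rewrite (rsum_delta k0 (fun=> 1)).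
  split=> [k|]; first by apply: Rmult_le_pos => //; case: (hq x).
  rewrite (suma (q x)).
  have e : px x * (\rsum_(u : U) (al u * q x u)) = px x.
    rewrite -[LHS]rsumZr; apply: eq_bigr => y _.
    rewrite -[RHS](jointXYZ_sumZ P hq hW) -(eq_bigr _ (fun z _ => halJ x y z)) exchange_big /=.
    rewrite -rsumZl; apply: eq_bigr => u _; rewrite rsumZl joint_sumZ //; ring.
  by apply: (Rmult_eq_reg_l (px x)); lra.
have Pq x y k : P x y * q' x k = a k * (P x y * q x (phi k)).
  rewrite /q'; case: Rlt_dec => h /=; first by ring.
  have p0 : px x = 0.
    by have := @rsum_ge0 _ xpredT (P x) (fun y _ => P0 x y); rewrite -/(px x); lra.
  have -> : P x y = 0 by apply: (rsum_eq0 (fun y _ => P0 x y) p0).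
  by ring.
have eJ x y z k : joint P q' W' x y z k = a k * joint P q W x y z (phi k).
  by rewrite /joint Pq /W'; ring.
have eT x y z : jointXYZ P q' W' x y z = jointXYZ P q W x y z.
  rewrite -[RHS]halJ -(suma (fun u => joint P q W x y z u)); apply: eq_bigr => k _; exact: eJ.
have eM y k : margYU P q' y k = a k * margYU P q y (phi k).
  by rewrite /margYU -rsumZl; apply: eq_bigr => x _; rewrite Pq.
exists q', W'; split=> //; first by move=> k; apply: hW.
rewrite -hali -(suma info) /mutinf.
transitivity (\rsum_(k : 'I_K) \rsum_(x : X) \rsum_(y : Y) \rsum_(z : Z)
  (joint P q' W' x y z k * ln (joint P q' W' x y z k * margY P y
     / (margYU P q' y k * jointXYZ P q' W' x y z)))).
  rewrite [RHS]exchange_big /=; apply: eq_bigr => x _; rewrite [RHS]exchange_big /=; apply: eq_bigr => y _.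
  by rewrite [RHS]exchange_big.
apply: eq_bigr => k _; rewrite /info -rsumZl; apply: eq_bigr => x _.
rewrite -rsumZl; apply: eq_bigr => y _; rewrite -rsumZl; apply: eq_bigr => z _.
rewrite eJ eT eM; case: (a0 k) => [ak|<-]; last by ring.
rewrite Rmult_assoc; congr (_ * (_ * ln _)).
rewrite /Rdiv !Rinv_mult -[RHS]Rmult_1_l -(Rinv_r (a k)); last lra.
by ring.
Qed.

End Cardinality.

(** * Limits of simulating systems *)

Lemma Un_cv_const (a : R) : Un_cv (fun _ => a) a.
Proof. by move=> e e0; exists 0%N => n _; rewrite /Rdist Rminus_diag_eq // Rabs_R0. Qed.

Lemma Un_cv_ext (u w : nat -> R) (l : R) : (forall n, u n = w n) -> Un_cv u l -> Un_cv w l.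
Proof. by move=> e h eps eps0; have [N hN] := h eps eps0; exists N => n; rewrite -e; apply: hN. Qed.

Lemma Un_cv_rsum (T : finType) (F : nat -> T -> R) (G : T -> R) :
  (forall t, Un_cv (fun n => F n t) (G t)) ->
  Un_cv (fun n => \rsum_(t : T) F n t) (\rsum_(t : T) G t).
Proof.
move=> h; rewrite -big_enum /=; apply: (@Un_cv_ext (fun n => \big[Rplus/R0]_(t <- enum T) F n t)).
  by move=> n; rewrite big_enum.
elim: (enum T) => [|a s ih].
  rewrite big_nil; apply: Un_cv_ext (Un_cv_const _) => n; by rewrite big_nil.
rewrite big_cons; apply: (@Un_cv_ext (fun n => F n a + \big[Rplus/R0]_(t <- s) F n t)).
  by move=> n; rewrite big_cons.
exact: CV_plus.
Qed.

Lemma Un_cv_le (u : nat -> R) (l c : R) : Un_cv u l -> (forall n, u n <= c + / INR n.+1) -> l <= c.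
Proof.
move=> h hu; apply: Rnot_lt_le => lt.
have [N1 hN1] := h ((l - c) / 2) ltac:(lra).
have [n [_ hn]] := @nat_floor (2 / (l - c)) (ltac:(apply/Rlt_le/Rdiv_lt_0_compat; lra)).
have := hN1 (N1 + n)%N (ltac:(apply/leP; apply: leq_addr)).
rewrite /Rdist => /Rabs_def2 [_ h2].
have hi : / INR (N1 + n).+1 < (l - c) / 2.
  have -> : (l - c) / 2 = / (2 / (l - c)) by field; lra.
  apply: Rinv_lt_contravar; last by rewrite S_INR plus_INR; have := pos_INR N1; lra.
  by apply: Rmult_lt_0_compat; [apply: Rdiv_lt_0_compat; lra | apply: lt_0_INR; apply/ltP].
have := hu (N1 + n)%N; lra.
Qed.

Lemma Un_cv_subseq (u : nat -> R) (l : R) (phi : nat -> nat) :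
  (forall n, (n <= phi n)%N) -> Un_cv u l -> Un_cv (fun n => u (phi n)) l.
Proof.
move=> hphi h eps eps0; have [N hN] := h eps eps0; exists N => n /leP hn.
by apply: hN; apply/leP/(leq_trans hn).
Qed.

(** Recording [n <= phi n] instead of monotonicity is enough to keep limits, and it is stable under
    composition. *)
Lemma bounded_subseq (u : nat -> R) : (forall n, 0 <= u n <= 1) ->
  exists phi : nat -> nat, (forall n, (n <= phi n)%N) /\ exists l, Un_cv (fun n => u (phi n)) l.
Proof.
move=> hu; have [l hl] := @Bolzano_Weierstrass u _ (compact_P3 0 1) hu.
have hp n : {p : nat | (n <= p)%N /\ Rabs (u p - l) < / INR n.+1}.
  apply: constructive_indefinite_description.
  have i0 : 0 < / INR n.+1 by apply/Rinv_0_lt_compat/lt_0_INR/ltP.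
  have [p [/leP h1 h2]] := hl (disc l (mkposreal _ i0)) n
    (ex_intro _ (mkposreal _ i0) (fun x h => h)).
  by exists p.
exists (fun n => sval (hp n)); split=> [n|]; first by case: (svalP (hp n)).
exists l => eps eps0.
have [N [_ hN]] := @nat_floor (/ eps) (ltac:(apply/Rlt_le/Rinv_0_lt_compat; lra)).
exists N => n /leP hn; have [_ h] := svalP (hp n).
apply: Rlt_trans h _; rewrite -(Rinv_inv eps).
have := le_INR _ _ (leP hn) => hn'.
apply: Rinv_lt_contravar; last by rewrite S_INR; lra.
by apply: Rmult_lt_0_compat; [apply: Rinv_0_lt_compat | apply: lt_0_INR; apply/ltP].
Qed.

Lemma finite_subseq (T : finType) (f : nat -> T -> R) : (forall n t, 0 <= f n t <= 1) ->
  exists (phi : nat -> nat) (g : T -> R), (forall n, (n <= phi n)%N) /\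
    forall t, Un_cv (fun n => f (phi n) t) (g t).
Proof.
move=> hf.
suff h (s : seq T) : exists phi : nat -> nat, (forall n, (n <= phi n)%N) /\
    forall t, t \in s -> exists l, Un_cv (fun n => f (phi n) t) l.
  have [phi [h1 h2]] := h (enum T).
  have hg t : {l : R | Un_cv (fun n => f (phi n) t) l}.
    by apply: constructive_indefinite_description; apply: h2; rewrite mem_enum.
  by exists phi, (fun t => sval (hg t)); split=> // t; apply: (svalP (hg t)).
elim: s => [|a s [phi [h1 h2]]]; first by exists id.
have [psi [h3 [l hl]]] := @bounded_subseq (fun n => f (phi n) a) (fun n => hf _ _).
exists (fun n => phi (psi n)); split=> [n|t]; first exact: leq_trans (h3 n) (h1 _).
rewrite inE => /orP[/eqP ->|/h2 [l' hl']]; first by exists l.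
by exists l'; apply: (Un_cv_subseq h3 hl').
Qed.

(** Gives continuity of [eta] at 0. It comes from [eta x = 2 * sqrt x * eta (sqrt x)] and
    [eta_le1]. *)
Lemma eta_sqrt_bound (x : R) : 0 <= x <= 1 -> 0 <= eta x <= 2 * sqrt x.
Proof.
case=> [[x0|<-] x1]; last by rewrite eta0 sqrt_0; lra.
have l0 : ln x <= 0 by rewrite -ln_1; apply: ln_le.
split; first by rewrite /eta; nra.
have s0 := sqrt_lt_R0 _ x0.
have e : eta x = 2 * sqrt x * eta (sqrt x).
  rewrite /eta -{1 2}(sqrt_sqrt x) ?ln_mult //; [ring | lra].
rewrite e -[X in _ <= X]Rmult_1_r; apply: Rmult_le_compat_l; first lra.
by apply: eta_le1; lra.
Qed.

Lemma Un_cv_eta (u : nat -> R) (l : R) : (forall n, 0 <= u n) -> 0 <= l ->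
  Un_cv u l -> Un_cv (fun n => eta (u n)) (eta l).
Proof.
move=> u0 [l0|<-] h.
  apply: CV_opp; apply: CV_mult => //; apply: continuity_seq => //.
  apply: derivable_continuous_pt; exists (/ l); exact: derivable_pt_lim_ln.
rewrite eta0 => eps eps0.
pose d := Rmin 1 ((eps / 2) ^ 2).
have p0 : 0 < (eps / 2) ^ 2 by apply: pow_lt; lra.
have [N hN] := h d (ltac:(apply: Rmin_glb_lt; lra)).
exists N => n hn; have := hN n hn; rewrite /Rdist !Rminus_0_r => /Rabs_def2 [hd _].
have d1 : d <= 1 by apply: Rmin_l.
have d2 : d <= (eps / 2) ^ 2 by apply: Rmin_r.
have un : 0 <= u n <= 1 by split; [exact: u0 | lra].
have [e1 e2] := eta_sqrt_bound un.
rewrite Rabs_pos_eq //; apply: Rle_lt_trans e2 _.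
have : sqrt (u n) < sqrt ((eps / 2) ^ 2) by apply: sqrt_lt_1_alt; split=> //; lra.
by rewrite sqrt_pow2; lra.
Qed.

Lemma pmf_le1 (T : finType) (p : T -> R) t : pmf p -> 0 <= p t <= 1.
Proof.
move=> [p0 p1]; split=> //; rewrite -p1; exact: (rsum_ge_term (P := xpredT)).
Qed.

Section Closure.
Variables (X Y Z : finType) (P : X -> Y -> R) (T : X -> Y -> Z -> R).
Hypothesis hP : pmf2 P.
Let K := (#|X| * #|Y| * #|Z| + 2)%N.

(* The entropy of the varying (X,Y,Z)-marginal is subtracted on both sides because the
   converse only controls the average of this difference over the letters. *)
Lemma feasible_limit (r : R) :
  (forall eps, 0 < eps -> exists (U : finType) (q : X -> U -> R) (W : U -> Y -> Z -> R),
    [/\ channel q, forall u, channel (W u),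
     forall x y z, Rabs (jointXYZ P q W x y z - T x y z) <= eps &
     mutinf P q W - \rsum_(x : X) \rsum_(y : Y) \rsum_(z : Z) eta (jointXYZ P q W x y z)
     <= r - \rsum_(x : X) \rsum_(y : Y) \rsum_(z : Z) eta (T x y z) + eps]) ->
  exists (q : X -> 'I_K -> R) (W : 'I_K -> Y -> Z -> R),
    [/\ channel q, forall k, channel (W k), forall x y z, jointXYZ P q W x y z = T x y z &
     mutinf P q W <= r].
Proof.
move=> happrox.
set HT := \rsum_(x : X) _ in happrox.
(* What remains of the entropy form of the information once H(X,Y,Z) is taken away. *)
pose G (q : X -> 'I_K -> R) (W : 'I_K -> Y -> Z -> R) : R :=
  \rsum_(y : Y) \rsum_(u : 'I_K) eta (margYU P q y u)
  - \rsum_(x : X) \rsum_(y : Y) \rsum_(z : Z) \rsum_(u : 'I_K) eta (joint P q W x y z u)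
  - \rsum_(y : Y) eta (margY P y).
have GE q W : channel q -> (forall k, channel (W k)) -> mutinf P q W =
    \rsum_(x : X) \rsum_(y : Y) \rsum_(z : Z) eta (jointXYZ P q W x y z) + G q W.
  by move=> hq hW; rewrite mutinf_entropy // /G /Rminus !Rplus_assoc.
have hs n : {qW : (X -> 'I_K -> R) * ('I_K -> Y -> Z -> R) |
    [/\ channel qW.1, forall k, channel (qW.2 k),
      forall x y z, Rabs (jointXYZ P qW.1 qW.2 x y z - T x y z) <= / INR n.+1 &
      G qW.1 qW.2 <= r - HT + / INR n.+1]}.
  apply: constructive_indefinite_description.
  have [U [q [W [hq hW hT hm]]]] := happrox (/ INR n.+1)
     ltac:(apply/Rinv_0_lt_compat/lt_0_INR/ltP => //).
  have [q' [W' [hq' hW' hT' hm']]] := cardinality_bound hP hq hW.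
  exists (q', W'); split=> //= [x y z|]; first by rewrite hT'.
  have cancel_sum (a b c : R) : a = b -> c <= a + c - b by lra.
  apply: Rle_trans hm; rewrite -hm' GE //; apply: cancel_sum.
  by apply: eq_bigr => x _; apply: eq_bigr => y _; apply: eq_bigr => z _; rewrite hT'.
pose qs n := (sval (hs n)).1; pose Ws n := (sval (hs n)).2.
(* Both channels are packed into one finite family of numbers in the unit interval, so that a single
   subsequence serves all entries. *)
pose f n (t : X * 'I_K + 'I_K * Y * Z) : R := match t with
  | inl a => qs n a.1 a.2 | inr b => Ws n b.1.1 b.1.2 b.2 end.
have hf n t : 0 <= f n t <= 1.
  have [hq hW _ _] := svalP (hs n).
  by case: t => [[x k]|[[k y] z]]; [exact: (pmf_le1 k (hq x)) | exact: (pmf_le1 z (hW k y))].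
have [phi [g [hphi hg]]] := finite_subseq hf.
pose q x k := g (inl (x, k)); pose W k y z := g (inr (k, y, z)).
have cvq x k : Un_cv (fun n => qs (phi n) x k) (q x k) by exact: hg (inl (x, k)).
have cvW k y z : Un_cv (fun n => Ws (phi n) k y z) (W k y z) by exact: hg (inr (k, y, z)).
have lim_ge0 u l : (forall n, 0 <= u n) -> Un_cv u l -> 0 <= l.
  by move=> u0 hl; apply: (Rle_cv_lim u0 (Un_cv_const 0) hl).
have lim_pmf (A : finType) (p : nat -> A -> R) (p' : A -> R) :
    (forall n, pmf (p n)) -> (forall a, Un_cv (fun n => p n a) (p' a)) -> pmf p'.
  move=> hp hc; split=> [a|]; first by apply: lim_ge0 (hc a) => n; case: (hp n).
  apply: (UL_sequence (fun n => \rsum_(a : A) p n a)); first exact: Un_cv_rsum.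
  by apply: Un_cv_ext (Un_cv_const 1) => n; case: (hp n).
have hqs n : channel (qs n) by have [h _ _ _] := svalP (hs n); exact: h.
have hWs n k : channel (Ws n k) by have [_ h _ _] := svalP (hs n); exact: (h k).
have hq : channel q.
  by move=> x; apply: (lim_pmf _ (fun n => qs (phi n) x)) => [n|k]; [exact: hqs | exact: cvq].
have hW k : channel (W k).
  by move=> y; apply: (lim_pmf _ (fun n => Ws (phi n) k y)) => [n|z]; [exact: hWs | exact: cvW].
have cvJ x y z k : Un_cv (fun n => joint P (qs (phi n)) (Ws (phi n)) x y z k) (joint P q W x y z k).
  apply: CV_mult => //; apply: CV_mult => //; exact: Un_cv_const.
have cvT x y z : Un_cv (fun n => jointXYZ P (qs (phi n)) (Ws (phi n)) x y z) (jointXYZ P q W x y z).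
  exact: Un_cv_rsum.
have cvM y k : Un_cv (fun n => margYU P (qs (phi n)) y k) (margYU P q y k).
  apply: Un_cv_rsum => x; apply: CV_mult => //; exact: Un_cv_const.
have cvG : Un_cv (fun n => G (qs (phi n)) (Ws (phi n))) (G q W).
  apply: CV_minus; last exact: Un_cv_const.
  apply: CV_minus.
    by apply: Un_cv_rsum => y; apply: Un_cv_rsum => k; apply: Un_cv_eta => // [n|]; apply: margYU_ge0.
  apply: Un_cv_rsum => x; apply: Un_cv_rsum => y; apply: Un_cv_rsum => z; apply: Un_cv_rsum => k.
  by apply: Un_cv_eta => // [n|]; apply: joint_ge0.
have inv_phi n : / INR (phi n).+1 <= / INR n.+1.
  apply: Rinv_le_contravar; first by apply/lt_0_INR/ltP.
  by apply: le_INR; apply/leP; rewrite ltnS.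
have hT x y z : jointXYZ P q W x y z = T x y z.
  have h1 n : Rabs (jointXYZ P (qs (phi n)) (Ws (phi n)) x y z - T x y z) <= / INR n.+1.
    by have [_ _ h _] := svalP (hs (phi n)); apply: Rle_trans (h x y z) (inv_phi n).
  apply: Rle_antisym.
    apply: (Un_cv_le (cvT x y z)) => n.
    by have := Rle_trans _ _ _ (Rle_abs _) (h1 n); lra.
  apply: Ropp_le_cancel; apply: (Un_cv_le (CV_opp _ _ (cvT x y z))) => n.
  rewrite /opp_seq; have := h1 n; rewrite -Rabs_Ropp => h2.
  by have := Rle_trans _ _ _ (Rle_abs _) h2; lra.
exists q, W; split=> //.
have hG : G q W <= r - HT.
  apply: (Un_cv_le cvG) => n; have [_ _ _ h] := svalP (hs (phi n)).
  by have := inv_phi n; rewrite /qs /Ws; lra.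
rewrite GE //; have sum_le (a c : R) : a = HT -> c <= r - HT -> a + c <= r by lra.
apply: sum_le hG.
by apply: eq_bigr => x _; apply: eq_bigr => y _; apply: eq_bigr => z _; rewrite hT.
Qed.

End Closure.

(** * The optimum *)

(** Gibbs' inequality against the law in which (X,Z) and U are independent given Y. *)
Lemma mutinf_ge0 (X Y Z U : finType) (P : X -> Y -> R) (q : X -> U -> R) (W : U -> Y -> Z -> R) :
  pmf2 P -> channel q -> (forall u, channel (W u)) -> 0 <= mutinf P q W.
Proof.
move=> hP hq hW.
pose Q x y z u := margYU P q y u * jointXYZ P q W x y z / margY P y.
pose flat (F : X -> Y -> Z -> U -> R) := fun a : X * Y * Z * U => F a.1.1.1 a.1.1.2 a.1.2 a.2.
have e F : \rsum_(x : X) \rsum_(y : Y) \rsum_(z : Z) \rsum_(u : U) F x y z u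
    = \rsum_(a : X * Y * Z * U) flat F a.
  by rewrite rsum_pair rsum_pair rsum_pair.
have J0 := joint_ge0 hP hq hW.
have T0 := jointXYZ_ge0 hP hq hW.
have Y0 := margY_ge0 hP.
have M0 := margYU_ge0 hP hq.
have Q0 x y z u : 0 <= Q x y z u.
  rewrite /Q /Rdiv; case: (Y0 y) => [h|h].
    apply: Rmult_le_pos; last exact/Rlt_le/Rinv_0_lt_compat.
    exact: Rmult_le_pos.
  have hx x' : P x' y = 0.
    by apply: (rsum_eq0 (P := xpredT) (F := fun x => P x y)) => // i _; case: hP.
  by rewrite /margYU rsum0 ?Rmult_0_l => [|x' _]; [lra | rewrite hx Rmult_0_l].
have sQ : \rsum_(a : X * Y * Z * U) flat Q a <= \rsum_(a : X * Y * Z * U) flat (joint P q W) a.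
  rewrite -!e joint_sum1 //.
  have eP : 1 = \rsum_(y : Y) margY P y by rewrite exchange_big; case: hP.
  rewrite eP exchange_big /=; apply: rsum_le => y _.
  apply: (Rle_trans _ (\rsum_(x : X) (P x y * (margY P y / margY P y)))).
    apply: rsum_le => x _; rewrite -(jointXYZ_sumZ P hq hW x y) -rsumZr; apply: Req_le.
    apply: eq_bigr => z _; rewrite /Q -{2}(margYU_sum P hq y).
    by rewrite /Rdiv !rsumZr; ring.
  rewrite rsumZr -/(margY P y); case: (Y0 y) => [h|<-]; last by rewrite Rmult_0_l; lra.
  by apply: Req_le; field; lra.
have posQ x y z u : 0 < joint P q W x y z u -> 0 < Q x y z u.
  move=> /(joint_pos hP hq hW) [h1 h2 h3].
  by apply: Rdiv_lt_0_compat => //; apply: Rmult_lt_0_compat.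
have := @gibbs _ (flat (joint P q W)) (flat Q) (fun a => J0 _ _ _ _) (fun a => Q0 _ _ _ _)
  (fun a => @posQ _ _ _ _) sQ.
have -> : mutinf P q W = \rsum_(a : X * Y * Z * U) (flat (joint P q W) a * ln (flat (joint P q W) a)
   - flat (joint P q W) a * ln (flat Q a)).
  rewrite /mutinf e; apply: eq_bigr => -[[[x y] z] u] _; rewrite /flat /= /Q.
  case: (J0 x y z u) => [h|<-]; last by ring.
  have [h1 h2 h3] := joint_pos hP hq hW h; move: (joint P q W x y z u) h => j h.
  rewrite -Rmult_minus_distr_l; congr (_ * _).
  have i1 := Rinv_0_lt_compat _ h1.
  have h23 := Rmult_lt_0_compat _ _ h2 h3.
  rewrite /Rdiv (ln_mult (j * _)) //; [|exact: Rmult_lt_0_compat|exact: Rinv_0_lt_compat].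
  by rewrite (ln_mult j) // ln_Rinv // (ln_mult (_ * _)) // ln_Rinv //; ring.
rewrite rsumB; lra.
Qed.

(** * Markov conditions and pairs of channels *)

Section Factorization.
Variables (X Y Z U : finType) (P : X -> Y -> R) (pZ : X -> Y -> Z -> R).
Hypotheses (hP : pmf2 P) (hZ : forall x y, pmf (pZ x y)).

Lemma log_mutinf (q : X -> U -> R) (W : U -> Y -> Z -> R) (pU : X -> Y -> Z -> U -> R) :
  channel q -> (forall u, channel (W u)) ->
  (forall x y z u, jointU P pZ pU u x y z = joint P q W x y z u) ->
  I_XZ_U_given_Y P pZ pU = mutinf P q W / ln 2.
Proof.
move=> hq hW hJ; rewrite /I_XZ_U_given_Y /cond_mi.
pose t x y z u := joint P q W x y z u * ln (joint P q W x y z u * margY P y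
  / (margYU P q y u * jointXYZ P q W x y z)) / ln 2.
transitivity (\rsum_(x : X) \rsum_(y : Y) \rsum_(z : Z) \rsum_(u : U) t x y z u); last first.
  rewrite /mutinf [RHS]/Rdiv -rsumZr; apply: eq_bigr => x _; rewrite -rsumZr; apply: eq_bigr => y _.
  by rewrite -rsumZr; apply: eq_bigr => z _; rewrite -rsumZr.
rewrite rsum_pair /=; apply: eq_bigr => x _.
rewrite [RHS]exchange_big /=; apply: eq_bigr => z _; rewrite [RHS]exchange_big /=.
apply: eq_bigr => u _; apply: eq_bigr => y _; rewrite /t.
rewrite (_ : \rsum_(a' : X * Z) \rsum_(b' : U) jointU P pZ pU b' a'.1 y a'.2 = margY P y); last first.
  rewrite rsum_pair /=; apply: eq_bigr => x' _; rewrite -(jointXYZ_sumZ P hq hW).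
  by apply: eq_bigr => z' _; apply: eq_bigr => u' _.
rewrite (_ : \rsum_(b' : U) jointU P pZ pU b' x y z = jointXYZ P q W x y z); last first.
  by apply: eq_bigr => u' _.
rewrite (_ : \rsum_(a' : X * Z) jointU P pZ pU u a'.1 y a'.2 = margYU P q y u); last first.
  rewrite rsum_pair /=; apply: eq_bigr => x' _; rewrite -(joint_sumZ P q hW).
  by apply: eq_bigr => z' _.
rewrite hJ; case: Rlt_dec => h /=.
  by rewrite /log2 /Rdiv (Rmult_comm (jointXYZ _ _ _ _ _ _)); ring.
case: (joint_ge0 hP hq hW x y z u) => [h'|<-]; [lra | rewrite /Rdiv; ring].
Qed.

(** Dividing the two product-form Markov equations by p(x) and by p(u,y) yields the channels p(u|x)
    and p(z|u,y). On null conditioning events some law must still be supplied; the joint law does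
    not see which. *)
Lemma markov_factor (pU : X -> Y -> Z -> U -> R) :
  cond_pmf_U pU -> markov_UXY P pZ pU -> markov_ZUYX P pZ pU ->
  exists (q : X -> U -> R) (W : U -> Y -> Z -> R),
    [/\ channel q, forall u, channel (W u) &
     forall x y z u, jointU P pZ pU u x y z = joint P q W x y z u].
Proof.
move=> hU m1 m2.
have P0 x y : 0 <= P x y by case: hP.
have [x0] := pmf2_inhab hP.
have [y0] : inhabited Y.
  case: (pickP (@predT Y)) => [y _|h]; first by constructor.
  have := proj2 hP; rewrite rsum0 => [|x _]; first lra.
  by rewrite big_pred0.
have z0 := pmf_inhab (hZ x0 y0).
pose J := jointU P pZ pU.
have J0 u x y z : 0 <= J u x y z.
  apply: Rmult_le_pos; last by case: (hU x y z).
  by apply: Rmult_le_pos => //; case: (hZ x y).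
pose F u x y := \rsum_(z : Z) J u x y z.
have F0 u x y : 0 <= F u x y by apply: rsum_ge0.
have Fsum x y : \rsum_(u : U) F u x y = P x y.
  rewrite exchange_big /= (eq_bigr (fun z => P x y * pZ x y z)) => [|z _].
    by rewrite rsumZl (proj2 (hZ x y)) Rmult_1_r.
  by rewrite /J /jointU rsumZl (proj2 (hU x y z)) Rmult_1_r.
pose px x := \rsum_(y : Y) P x y.
pose a u x := \rsum_(y : Y) F u x y.
pose q x u := if Rlt_dec 0 (px x) then a u x / px x else pU x y0 z0 u.
have asum x : \rsum_(u : U) a u x = px x.
  by rewrite exchange_big /=; apply: eq_bigr.
have hq : channel q.
  move=> x; rewrite /q; case: Rlt_dec => h /=; last exact: hU.
  split=> [u|]; last by rewrite rsumZr asum; field; lra.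
  by apply: Rmult_le_pos; [apply: rsum_ge0 | apply/Rlt_le/Rinv_0_lt_compat].
have Pq x y u : P x y * q x u = F u x y.
  have := m1 u x y; rewrite -/(F u x y) -/(a u x).
  rewrite (_ : \rsum_(a' : U) _ = px x); last exact: asum.
  rewrite (_ : \rsum_(a' : U) _ = P x y); last exact: Fsum.
  rewrite /q; case: Rlt_dec => h /= e.
    have -> : F u x y = F u x y * px x / px x by field; lra.
    by rewrite e /Rdiv; ring.
  have p0 : P x y = 0.
    apply: (rsum_eq0 (P := xpredT) (F := P x)) => //.
    by have := @rsum_ge0 _ xpredT (P x) (fun y _ => P0 x y); rewrite -/(px x); lra.
  rewrite p0 Rmult_0_l; apply: esym; apply: (rsum_eq0 (P := xpredT) (F := fun u => F u x y)) => //.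
  by rewrite Fsum.
pose b z u y := \rsum_(x : X) J u x y z.
pose c u y := \rsum_(x : X) F u x y.
have bsum u y : \rsum_(z : Z) b z u y = c u y by rewrite exchange_big.
pose W u y z := if Rlt_dec 0 (c u y) then b z u y / c u y else pZ x0 y z.
have hW u : channel (W u).
  move=> y; rewrite /W; case: Rlt_dec => h /=; last exact: hZ.
  split=> [z|]; last by rewrite rsumZr bsum; field; lra.
  by apply: Rmult_le_pos; [apply: rsum_ge0 | apply/Rlt_le/Rinv_0_lt_compat].
exists q, W; split=> // x y z u.
rewrite /joint Pq /W -/(J u x y z).
have := m2 z (u, y) x => /=.
rewrite -/(J u x y z) (_ : \rsum_(a' : Z) \rsum_(c' : X) _ = c u y); last exact: bsum.
rewrite -/(b z u y) -/(F u x y); case: Rlt_dec => h /= e.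
  have -> : J u x y z = J u x y z * c u y / c u y by field; lra.
  by rewrite e /Rdiv; ring.
have f0 : F u x y = 0.
  apply: (rsum_eq0 (P := xpredT) (F := fun x => F u x y)) => //.
  by have := @rsum_ge0 _ xpredT (fun x => F u x y) (fun x _ => F0 u x y); rewrite -/(c u y); lra.
rewrite f0 Rmult_0_l; exact: (rsum_eq0 (P := xpredT) (F := J u x y)).
Qed.

Lemma factor_markov (q : X -> U -> R) (W : U -> Y -> Z -> R) :
  channel q -> (forall u, channel (W u)) ->
  (forall x y z, jointXYZ P q W x y z = P x y * pZ x y z) ->
  exists pU : X -> Y -> Z -> U -> R,
    [/\ cond_pmf_U pU, markov_UXY P pZ pU, markov_ZUYX P pZ pU &
     forall x y z u, jointU P pZ pU u x y z = joint P q W x y z u].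
Proof.
move=> hq hW hT; have J0 := joint_ge0 hP hq hW.
(* The posterior of U; on a triple of zero weight [q x] serves as an arbitrary law. *)
pose pU x y z u := if Rlt_dec 0 (P x y * pZ x y z) then joint P q W x y z u / (P x y * pZ x y z)
  else q x u.
have hU : cond_pmf_U pU.
  move=> x y z; rewrite /pU; case: Rlt_dec => h /=; last exact: hq.
  split=> [u|]; last by rewrite rsumZr -/(jointXYZ P q W x y z) hT Rinv_r //; lra.
  by apply: Rmult_le_pos => //; apply/Rlt_le/Rinv_0_lt_compat.
have hJ x y z u : jointU P pZ pU u x y z = joint P q W x y z u.
  rewrite /jointU /pU; case: Rlt_dec => h /=; first by rewrite /Rdiv Rmult_comm Rmult_assoc Rinv_l; lra.
  have T0 : jointXYZ P q W x y z = 0.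
    by have := jointXYZ_ge0 hP hq hW x y z; rewrite hT; lra.
  by rewrite -hT T0 Rmult_0_l (rsum_eq0 (P := xpredT) (fun u _ => J0 x y z u) T0).
have hF x y u : \rsum_(z : Z) jointU P pZ pU u x y z = P x y * q x u.
  by rewrite -(joint_sumZ P q hW); apply: eq_bigr => z _.
exists pU; split=> //.
- move=> u x y; rewrite hF.
  rewrite (eq_bigr (fun a' => \rsum_(c' : Y) (P x c' * q x a'))); last first.
    by move=> a' _; apply: eq_bigr => c' _; rewrite hF.
  rewrite [in RHS](eq_bigr (fun c' => P x c' * q x u)); last by move=> c' _; rewrite hF.
  rewrite [X in _ = _ * X](eq_bigr (fun a' => P x y * q x a')); last by move=> a' _; rewrite hF.
  rewrite rsumZr rsumZl (proj2 (hq x)) exchange_big /=.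
  rewrite (eq_bigr (P x)) => [|y' _]; first by ring.
  by rewrite rsumZl (proj2 (hq x)) Rmult_1_r.
- move=> z [u y] x /=; rewrite hJ hF exchange_big /=.
  rewrite (eq_bigr (fun x' => P x' y * q x' u)) => [|x' _]; last exact: hF.
  rewrite [X in _ = X * _](eq_bigr (fun x' => P x' y * q x' u * W u y z)) => [|x' _]; last exact: hJ.
  by rewrite rsumZr /joint; ring.
Qed.

End Factorization.

Section Optimum.
Variables (X Y Z : finType) (P : X -> Y -> R) (pZ : X -> Y -> Z -> R).
Hypotheses (hP : pmf2 P) (hZ : forall x y, pmf (pZ x y)).
Let K := (#|X| * #|Y| * #|Z| + 2)%N.

Definition simulates (U : finType) (q : X -> U -> R) (W : U -> Y -> Z -> R) : Prop :=
  [/\ channel q, forall u, channel (W u) &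
   forall x y z, jointXYZ P q W x y z = P x y * pZ x y z].

Lemma optimum_exists : exists (q : X -> 'I_K -> R) (W : 'I_K -> Y -> Z -> R),
  simulates q W /\
  forall (U : finType) (q' : X -> U -> R) (W' : U -> Y -> Z -> R),
    simulates q' W' -> mutinf P q W <= mutinf P q' W'.
Proof.
(* For exact simulators the entropies on the two sides agree, so the closure statement becomes one
   about the information alone. *)
have limit r : (forall eps, 0 < eps -> exists (U : finType) (q : X -> U -> R) (W : U -> Y -> Z -> R),
    simulates q W /\ mutinf P q W <= r + eps) ->
    exists (q : X -> 'I_K -> R) (W : 'I_K -> Y -> Z -> R), simulates q W /\ mutinf P q W <= r.
  move=> h; have [|q [W [hq hW hT hm]]] := @feasible_limit X Y Z P (fun x y z => P x y * pZ x y z) hP r.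
    move=> eps eps0; have [U [q [W [[hq hW hT] hm]]]] := h eps eps0.
    exists U, q, W; split=> // [x y z|]; first by rewrite hT Rminus_diag_eq // Rabs_R0; lra.
    have sub_le (a b m : R) : a = b -> m <= r + eps -> m - a <= r - b + eps by lra.
    apply: sub_le hm.
    by apply: eq_bigr => x _; apply: eq_bigr => y _; apply: eq_bigr => z _; rewrite hT.
  by exists q, W.
(* Values are negated because [completeness] provides suprema. *)
pose E s := exists (U : finType) (q : X -> U -> R) (W : U -> Y -> Z -> R),
  simulates q W /\ s = - mutinf P q W.
have Eb : bound E.
  exists 0 => s [U [q [W [[hq hW _] ->]]]].
  by have := mutinf_ge0 hP hq hW; lra.
have En : exists s, E s.
  (* The set is not empty: U = X simulates exactly, with [pZ] itself as Bob's channel. *)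
  pose q0 (x u : X) : R := if u == x then 1 else 0.
  exists (- mutinf P q0 pZ), X, q0, pZ; split=> //; split=> //.
    move=> x; split=> [u|]; first by rewrite /q0; case: ifP => _; lra.
    exact: (rsum_delta x (fun=> 1)).
  move=> x y z; rewrite -(rsum_delta x (fun u => P x y * pZ u y z)); apply: eq_bigr => u _.
  by rewrite /joint /q0; case: ifP => _; ring.
have [l [ub lub]] := completeness E Eb En.
have [|q [W [hs hm]]] := limit (- l).
  move=> eps eps0; apply: NNPP => hn.
  have : l <= l - eps; last by lra.
  apply: lub => s [U [q [W [hs ->]]]]; apply: Rnot_lt_le => hlt; apply: hn.
  by exists U, q, W; split=> //; lra.
exists q, W; split=> // U q' W' hs'.
have := ub (- mutinf P q' W') (ex_intro _ U (ex_intro _ q' (ex_intro _ W' (conj hs' erefl)))).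
lra.
Qed.

Lemma achievable_above (U : finType) (q : X -> U -> R) (W : U -> Y -> Z -> R) (Rate : R) :
  simulates q W -> mutinf P q W < Rate * ln 2 -> achievable P pZ Rate.
Proof.
move=> [hq hW hT] hr; have r0 : 0 <= Rate * ln 2 by have := mutinf_ge0 hP hq hW; lra.
have [C hC] := achievability_bound hP hq hW r0 hr.
have [x0] := pmf2_inhab hP.
have powE n : Rpower 2 (INR n * Rate) = exp (INR n * (Rate * ln 2)).
  by rewrite /Rpower Rmult_assoc.
have hcode n : {mc : {m : nat & code X Y Z n m} |
    [/\ valid_code (projT2 mc), INR (projT1 mc) <= Rpower 2 (INR n * Rate) &
     (0 < n)%N -> tv (induced P (projT2 mc)) (target P pZ (n:=n)) <= / 2 * (C / INR n)]}.
  apply: constructive_indefinite_description.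
  case: (posnP n) => [->|n0].
    (* At n = 0 the rate condition allows at most one message, and the asymptotic bound does not
       apply; a trivial code fills this place. *)
    exists (existT _ 1%N (Code (fun _ _ => 1) (fun _ y z => \rprod_(i < 0) pZ x0 (y i) (z i)))).
    split=> [||//]; last by rewrite powE Rmult_0_l exp_0 /=; lra.
    split=> [x|w y] /=; first by split=> [_|]; [lra | rewrite rsum_const card_ord /=; ring].
    split=> [z|]; first by rewrite big_ord0; lra.
    by rewrite (rsum_ffun_prod (fun i z => pZ x0 (y i) z)) big_ord0.
  have [m [c [hv hm hb]]] := hC n n0; exists (existT _ m c); split=> //=; first by rewrite powE.
  move=> _; apply: Rmult_le_compat_l; first lra.
  apply: Rle_trans hb; apply: Req_le.
  apply: eq_bigr => x _; apply: eq_bigr => y _; apply: eq_bigr => z _; congr (Rabs (_ - _)).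
  by apply: eq_bigr => i _; rewrite hT.
exists (fun n => projT1 (sval (hcode n))), (fun n => projT2 (sval (hcode n))); split=> [n|eps eps0].
  by have [h1 h2 _] := svalP (hcode n).
have [N [_ hN]] := @nat_floor (Rabs C / eps)
  (ltac:(apply: Rmult_le_pos; [exact: Rabs_pos | exact/Rlt_le/Rinv_0_lt_compat])).
exists N.+1 => n hn; have [_ _ h] := svalP (hcode n).
apply: Rle_trans (h (leq_ltn_trans (leq0n N) hn)) _.
have hNn : INR N + 1 <= INR n by rewrite -S_INR; apply: le_INR; apply/leP.
have n0 : 0 < INR n by have := pos_INR N; lra.
have hc : Rabs C <= eps * INR n.
  have -> : Rabs C = eps * (Rabs C / eps) by field; lra.
  by apply: Rmult_le_compat_l; lra.
have : C / INR n <= eps; last by lra.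
apply: (Rmult_le_reg_r (INR n)) => //.
have -> : C / INR n * INR n = C by field; lra.
by have := Rle_abs C; lra.
Qed.

End Optimum.

Theorem theorem2 (X Y Z : finType) (pXY : X -> Y -> R) (pZ : X -> Y -> Z -> R)
  (HXY : pmf2 pXY) (HZ : forall x y, pmf (pZ x y)) :
  exists RNS : R,
    is_inf (achievable pXY pZ) RNS /\
    (exists (U : finType) (pU : X -> Y -> Z -> U -> R),
        (#|U| <= #|X| * #|Y| * #|Z| + 2)%N /\
        cond_pmf_U pU /\ markov_UXY pXY pZ pU /\ markov_ZUYX pXY pZ pU /\
        I_XZ_U_given_Y pXY pZ pU = RNS) /\
    (forall (U : finType) (pU : X -> Y -> Z -> U -> R),
        cond_pmf_U pU -> markov_UXY pXY pZ pU -> markov_ZUYX pXY pZ pU ->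
        RNS <= I_XZ_U_given_Y pXY pZ pU).
Proof.
have [q [W [hs hmin]]] := optimum_exists HXY HZ; have [hq hW hT] := hs.
have l2 : 0 < ln 2 by have := ln_lt_2; lra.
have il2 := Rinv_0_lt_compat _ l2.
exists (mutinf pXY q W / ln 2); split; [split | split].
- move=> Rate /(converse HXY HZ) /(feasible_limit HXY) [q' [W' [hq' hW' hT' hm]]].
  have h : mutinf pXY q W <= Rate * ln 2 by apply: Rle_trans hm; apply: hmin.
  have -> : Rate = Rate * ln 2 / ln 2 by field; lra.
  by apply: Rmult_le_compat_r; lra.
- move=> b hb; apply: Rnot_lt_le => hlt.
  (* A rate strictly between the optimum and [b] is achievable, which contradicts that [b] is a
     lower bound. *)
  pose Rate := (b + mutinf pXY q W / ln 2) / 2.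
  have : b <= Rate; last by rewrite /Rate; lra.
  apply: hb; apply: (achievable_above HXY hs).
  have -> : mutinf pXY q W = mutinf pXY q W / ln 2 * ln 2 by field; lra.
  by apply: Rmult_lt_compat_r => //; rewrite /Rate; lra.
- have [pU [h1 h2 h3 h4]] := factor_markov HXY hq hW hT.
  exists 'I_(#|X| * #|Y| * #|Z| + 2), pU; rewrite card_ord; do 4 split=> //.
  exact: log_mutinf.
- move=> U pU h1 h2 h3.
  have [q' [W' [hq' hW' hJ]]] := markov_factor HXY HZ h1 h2 h3.
  rewrite (log_mutinf HXY hq' hW' hJ); apply: Rmult_le_compat_r; first lra.
  apply: hmin; split=> // x y z.
  rewrite /jointXYZ -(eq_bigr _ (fun u _ => hJ x y z u)) /jointU rsumZl.
  by rewrite (proj2 (h1 x y z)) Rmult_1_r.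
Qed.
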